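(* Let $n\geq 4$ be an even integer, let $0\leq a<n$ and $1<p<+\infty$ be real numbers, and let $u:\mathbb{R}^n\to\mathbb{R}$ be a nonnegative (classical) solution of $$(-\Delta)^{\frac n2}u(x)=\frac{u^p(x)}{|x|^a}\quad\text{in }\mathbb{R}^n,\qquad u(x)\geq 0\ \text{ for all }x\in\mathbb{R}^n,$$ where $u\in C^n(\mathbb{R}^n)$ if $a=0$, and $u\in C^n(\mathbb{R}^n\setminus\{0\})\cap C^{n-2}(\mathbb{R}^n)$ if $0<a<n$. Assume that at least one of the following two conditions holds: (1) $0\leq a\leq 2+2p$; (2) $u(x)=o(|x|^2)$ as $|x|\to+\infty$. Then $u\equiv 0$ in $\mathbb{R}^n$.
   Context: Here $\Delta=\sum_{j=1}^n\partial_{x_j}^2$ is the Laplacian on $\mathbb{R}^n$, and since $n$ is even, $(-\Delta)^{\frac n2}$ is the $\frac n2$-fold iterate of $-\Delta$ (a differential operator of order $n$). Solutions are classical: the equation holds pointwise, at every $x\in\mathbb{R}^n$ if $a=0$ and at every $x\in\mathbb{R}^n\setminus\{0\}$ if $0<a<n$ (where $u$ is only assumed to be $C^{n-2}$ across the origin). *)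

(* Defs.v *)
From HB Require Import structures.
From mathcomp Require Import all_boot all_order all_algebra.
From mathcomp Require Import all_classical all_reals all_analysis.

Set Implicit Arguments.
Unset Strict Implicit.
Unset Printing Implicit Defensive.

Import Order.TTheory GRing.Theory Num.Theory.
Import numFieldNormedType.Exports.

Local Open Scope classical_set_scope.
Local Open Scope ring_scope.

(* The library norm `|x| on 'rV[R]_n is the sup norm, so the Euclidean norm
   is defined separately; both induce the same topology. *)
Definition enorm (R : realType) (n : nat) (x : 'rV[R]_n) : R :=
  Num.sqrt (\sum_(i < n) x ord0 i ^+ 2).

Definition partial (R : realType) (n : nat) (i : 'I_n) (f : 'rV[R]_n -> R) :
    'rV[R]_n -> R :=
  fun x => 'D_(delta_mx ord0 i) f x.

(* f is of class C^k on U: all the iterated partial derivatives of f of order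
   at most k exist and are continuous at every point of U. Meant for open U:
   derivability and continuity at a point of U are those of f on the whole
   space, which then only depend on the restriction of f to U. *)
Fixpoint Ck_on (R : realType) (n : nat) (k : nat) (U : set 'rV[R]_n)
    (f : 'rV[R]_n -> R) : Prop :=
  (forall x, U x -> {for x, continuous f}) /\
  match k with
  | 0 => True
  | k'.+1 => forall i : 'I_n,
      (forall x, U x -> derivable f x (delta_mx ord0 i)) /\
      Ck_on k' U (partial i f)
  end.

Definition laplacian (R : realType) (n : nat) (f : 'rV[R]_n -> R) :
    'rV[R]_n -> R :=
  fun x => \sum_(i < n) partial i (partial i f) x.

(* (- Delta)^m *)
Definition neg_laplacian_iter (R : realType) (n m : nat)
    (f : 'rV[R]_n -> R) : 'rV[R]_n -> R :=
  iter m (fun g x => - laplacian g x) f.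

(* The filter "|x| -> +oo" on R^n. *)
Definition at_infinity (R : realType) (n : nat) : set_system 'rV[R]_n :=
  filter_from [set: R] (fun M => [set x : 'rV[R]_n | M < enorm x]).
Arguments at_infinity : clear implicits.

#[global] Instance at_infinity_filter (R : realType) (n : nat) :
  Filter (at_infinity R n).
Proof.
apply: filter_from_filter; first by exists 0.
move=> M N _ _; exists (Num.max M N) => //= x /=.
by rewrite gt_max => /andP[].
Qed.

(* Makes the little-o notation of the library available for this filter. *)
Canonical at_infinity_filter_on (R : realType) (n : nat) :=
  FilterType (at_infinity R n) (at_infinity_filter R n).

(* Main.v *)
Require Import Defs.
From HB Require Import structures.
From mathcomp Require Import all_boot all_order all_algebra.
From mathcomp Require Import all_classical all_reals all_analysis.
From mathcomp Require Import ring lra.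
Import Order.TTheory GRing.Theory Num.Theory.
Import numFieldNormedType.Exports.
Local Open Scope classical_set_scope.
Local Open Scope ring_scope.
Set Implicit Arguments.
Unset Strict Implicit.
Unset Printing Implicit Defensive.

(* The test function method of Mitidieri and Pokhozhaev. Write m = n/2 and
   f = (-Delta)^m u = u^p / |x|^a. Take a cutoff phi_r equal to 1 on the cube
   |x| <= r and supported in |x| <= 2r, for the sup norm, which is a high power
   of a bump, so that |(-Delta)^m phi_r| <= B r^-n phi_r^(1/p). As a < n, for
   every T > 0 and all large r Young's inequality bounds u |(-Delta)^m phi_r| by
   f phi_r / 2 + T B r^-n, and the second term has an integral of order T because
   the order of the equation is the dimension. Integrating f phi_r by parts
   thus gives f = 0 off the origin.
   The singularity at 0 is avoided by testing with phi_r - phi_delta, which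
   vanishes near 0: since (-Delta)^(m-1) u is continuous at 0, the extra term
   int (-Delta)^(m-1) u (-Delta phi_delta) is O(delta^(n-2)).
   Integrals are replaced by Riemann sums over a grid of step h and the Laplacian
   by its second difference analogue, so that integration by parts is an exact
   rearrangement of finite sums; the iterated difference Laplacian of a C^2k
   function converges locally uniformly to the differential one as h -> 0. *)

(** * Functions of one variable *)

Section OneVariable.
Variable R : realType.
Implicit Types (f g G : R -> R) (t h : R).

(* Rolle's theorem applied to k t - (t / h)^2 k h, where
   k t = G t + G (- t) - 2 G 0, then the mean value theorem applied to G'. *)
Lemma second_difference_MVT G G1 G2 h : 0 < h ->
  (forall t, `|t| <= h -> is_derive t 1 G (G1 t)) ->
  (forall t, `|t| <= h -> is_derive t 1 G1 (G2 t)) ->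
  exists2 s, `|s| <= h & G h + G (- h) - 2 * G 0 = h ^+ 2 * G2 s.
Proof.
move=> h0 dG dG1.
pose k t := G t + G (- t) - 2 * G 0.
pose r t := k t - (t / h) ^+ 2 * k h.
have nrm t : 0 <= t <= h -> `|t| <= h by case/andP=> ? ?; rewrite ger0_norm.
have dk t : 0 <= t <= h -> is_derive t 1 k (G1 t - G1 (- t)).
  move=> th; rewrite /k.
  have := dG t (nrm _ th) => D1.
  have D2 : is_derive (- t) 1 G (G1 (- t)) by apply: dG; rewrite normrN nrm.
  have D3 : is_derive t 1 (fun t => G (- t)) (G1 (- t) * (- 1)).
    by apply: (@is_derive1_comp _ G -%R).
  by apply: is_derive_eq; rewrite subr0 mulrN1.
have dr t : 0 <= t <= h ->
    is_derive t 1 r (G1 t - G1 (- t) - 2 * t / h ^+ 2 * k h).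
  move=> th; rewrite /r; have D1 := dk _ th.
  have D2 : is_derive t 1 (fun t => t / h) (h^-1).
    have -> : (fun t => t / h) = (h^-1 \*: @id R).
      by apply/funext => x; rewrite /= /GRing.scale /= mulrC.
    by apply: is_derive_eq; rewrite /GRing.scale /= mulr1.
  apply: is_derive_eq.
  rewrite /GRing.scale /=.
  by field; rewrite gt_eqF.
have r0 : r 0 = 0 by rewrite /r /k mul0r expr0n /= mul0r oppr0; ring.
have rh : r h = 0 by rewrite /r divff ?gt_eqF// expr1n mul1r subrr.
have cr : {within `[0, h], continuous r}.
  apply: derivable_within_continuous => t; rewrite in_itv /= => th.
  exact: (@ex_derive _ _ _ _ _ _ _ (dr _ th)).
have [|s] := @Rolle R r 0 h h0 _ cr (etrans r0 (esym rh)).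
  move=> t; rewrite in_itv /= => /andP[t0 th].
  by apply: (@ex_derive _ _ _ _ _ _ _ (dr _ _)); rewrite !ltW.
rewrite in_itv /= => /andP[s0 sh] ds.
have sh' : 0 <= s <= h by rewrite !ltW.
have E1 : G1 s - G1 (- s) = 2 * s / h ^+ 2 * k h.
  have := @derive_val _ _ _ _ _ _ _ ds.
  by rewrite (@derive_val _ _ _ _ _ _ _ (dr _ sh')) => /eqP; rewrite subr_eq0 => /eqP.
have [] := @MVT R G1 G2 (- s) s; first by lra.
- move=> t; rewrite in_itv /= => ts; apply: dG1; rewrite ler_norml; lra.
- apply: derivable_within_continuous => t; rewrite in_itv /= => ts.
  by apply: (@ex_derive _ _ _ _ _ _ _ (dG1 _ _)); rewrite ler_norml; lra.
move=> th; rewrite in_itv /= => ths; rewrite E1 => E2.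
exists th; first by rewrite ler_norml; lra.
have -> : G h + G (- h) - 2 * G 0 = k h by [].
have : (2 * s) * (k h - h ^+ 2 * G2 th) = 0.
  have E3 : 2 * s * k h = h ^+ 2 * (2 * s / h ^+ 2 * k h).
    by field; rewrite gt_eqF.
  by rewrite mulrBr E3 E2; ring.
by move=> /eqP; rewrite mulf_eq0 gt_eqF ?mulr_gt0//= subr_eq0 => /eqP.
Qed.

(** The derivative is an existential witness, so closure under products and compositions amounts to
    exhibiting a formula for it. *)
Fixpoint Cm (k : nat) f : Prop :=
  match k with
  | 0 => continuous f
  | k'.+1 => exists2 f', (forall t, is_derive t 1 f (f' t)) & Cm k' f'
  end.

Lemma Cm_continuous k f : Cm k f -> continuous f.
Proof.
case: k => //= k [f' df _] x; apply: differentiable_continuous.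
by apply/derivable1_diffP; apply: (@ex_derive _ _ _ _ _ _ _ (df x)).
Qed.

Lemma CmS k f : Cm k.+1 f -> Cm k f.
Proof.
elim: k f => [f /Cm_continuous//|k IH f [f' df cf]].
by exists f' => //; exact: IH.
Qed.

Lemma Cm_cst k (c : R) : Cm k (cst c).
Proof.
elim: k c => [c|k IH c] /=; first exact: cst_continuous.
by exists (cst 0) => // t; apply: is_derive_eq.
Qed.

Lemma CmD k f g : Cm k f -> Cm k g -> Cm k (fun t => f t + g t).
Proof.
elim: k f g => [f g cf cg|k IH f g [f' df cf] [g' dg cg]] /=.
  by move=> x; apply: cvgD; [exact: cf|exact: cg].
exists (fun t => f' t + g' t); last exact: IH.
by move=> t; have := df t; have := dg t => ? ?; apply: is_deriveD.
Qed.

Lemma CmM k f g : Cm k f -> Cm k g -> Cm k (fun t => f t * g t).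
Proof.
elim: k f g => [f g cf cg|k IH f g Cf Cg] /=.
  by move=> x; apply: cvgM; [exact: cf|exact: cg].
case: (Cf) (Cg) => f' df cf [g' dg cg].
exists (fun t => f t * g' t + g t * f' t).
  by move=> t; have := df t; have := dg t => ? ?; apply: is_deriveM.
by apply: CmD; apply: IH => //; exact: CmS.
Qed.

Lemma CmN k f : Cm k f -> Cm k (fun t => - f t).
Proof.
move=> cf; have := CmM (Cm_cst k (-1)) cf.
by congr Cm; apply/funext => t /=; rewrite mulN1r.
Qed.

Lemma Cm_id k : Cm k (@id R).
Proof.
case: k => [|k] /=; first by move=> x; exact: cvg_id.
by exists (cst 1) => [t|]; [exact: is_derive_id|exact: Cm_cst].
Qed.

Lemma Cm_comp k f g : Cm k f -> Cm k g -> Cm k (f \o g).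
Proof.
elim: k f g => [f g cf cg|k IH f g Cf Cg] /=.
  by move=> x; apply: continuous_comp; [exact: cg|exact: cf].
case: (Cf) (Cg) => f' df cf [g' dg cg].
exists (fun t => f' (g t) * g' t).
  by move=> t; have := df (g t); have := dg t => ? ?; apply: is_derive1_comp.
by apply: CmM => //; apply: IH => //; exact: CmS.
Qed.

(** * Cutoff functions of one variable *)

Definition ppart t : R := Num.max t 0.

Lemma ppart_continuous : continuous ppart.
Proof. by move=> x; apply: continuous_max; [exact: cvg_id|exact: cvg_cst]. Qed.

(** Off 0 the function coincides locally with 0 or with t^2. At 0 its difference quotient max(h,
    0)^2 / h is at most |h| in absolute value. *)
Lemma ppart_sqr_derive t : is_derive t 1 (fun t => ppart t ^+ 2) (2 * ppart t).
Proof.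
case: (ltrgtP t 0) => t0.
- apply: (@near_eq_is_derive _ _ _ (cst 0)).
    have := @lt_nbhsl R t 0 t0; apply: filterS => x x0.
    by rewrite /ppart max_r ?expr0n// ltW.
  by rewrite /ppart max_r ?ltW// mulr0; apply: is_derive_eq.
- apply: (@near_eq_is_derive _ _ _ (fun t => t ^+ 2)).
    have := @lt_nbhsr R 0 t t0; apply: filterS => x x0.
    by rewrite /ppart max_l ?ltW.
  rewrite /ppart max_l ?ltW//.
  by apply: is_derive_eq; rewrite /GRing.scale /=; ring.
- rewrite t0 /ppart maxxx mulr0.
  have H : (fun h : R => h^-1 *:
      (((fun t => ppart t ^+ 2) \o shift 0) (h *: 1) - ppart 0 ^+ 2)) @ 0^' --> (0 : R).
    apply/cvgrPdist_le => e e0; near=> h.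
    have h0 : h != 0 by near: h; exact: nbhs_dnbhs_neq.
    rewrite sub0r normrN /= addr0 /ppart maxxx expr0n /= subr0 /GRing.scale /= mulr1.
    rewrite normrM normfV normrX ler_pdivrMl ?normr_gt0//.
    have he : `|h| <= e.
      near: h; apply: dnbhs0_le => //.
    have : `|Num.max h 0| <= `|h|.
      by case: (lerP h 0) => h1; [rewrite normr0|].
    move=> hh; rewrite expr2; apply: ler_pM => //; exact: le_trans he.
  apply: DeriveDef; first by apply/cvg_ex; exists 0.
  exact: cvg_lim H.
Unshelve. all: by end_near.
Qed.

(** As [ppart t] is 0 for t <= 0, one of its factors may be replaced by t; the product rule then
    never differentiates [ppart] itself, which has a corner at 0. *)
Lemma ppart_derive k t :
  is_derive t 1 (fun t => ppart t ^+ k.+2) (k.+2%:R * ppart t ^+ k.+1).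
Proof.
elim: k => [|k IH]; first by rewrite expr1; exact: ppart_sqr_derive.
have -> : (fun t => ppart t ^+ k.+3) = (fun t => t * ppart t ^+ k.+2).
  apply/funext => x; rewrite exprS /ppart.
  by case: (lerP x 0) => // _; rewrite expr0n /= !mulr0.
apply: is_derive_eq; rewrite /GRing.scale /= mulr1.
have -> : t * (k.+2%:R * ppart t ^+ k.+1) = k.+2%:R * ppart t ^+ k.+2.
  rewrite /ppart; case: (lerP t 0) => _; first by rewrite expr0n /= !mulr0 expr0n mulr0.
  by rewrite (exprS _ k.+1); ring.
by rewrite -natr1; ring.
Qed.

Lemma Cm_ppart k : Cm k (fun t => ppart t ^+ k.+1).
Proof.
elim: k => [|k IH] /=; first exact: ppart_continuous.
exists (fun t => k.+2%:R * ppart t ^+ k.+1); first exact: ppart_derive.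
exact: (CmM (Cm_cst k k.+2%:R) IH).
Qed.

Lemma Cm_bump N : exists zeta : R -> R,
  [/\ Cm N zeta, (forall t, 0 <= zeta t <= 1),
      (forall t, `|t| <= 1 -> zeta t = 1) & (forall t, 2 <= `|t| -> zeta t = 0)].
Proof.
pose q t := ppart t ^+ N.+1.
have q0 t : 0 <= q t by rewrite exprn_ge0// /ppart le_max lexx orbT.
have qN t : t <= 0 -> q t = 0.
  by move=> t0; rewrite /q /ppart max_r// expr0n.
have q1 t : 1 <= t -> 1 <= q t.
  move=> t1; rewrite /q /ppart max_l ?(le_trans _ t1)//.
  exact: exprn_ege1.
have q2 t : t <= 1 -> q t <= 1.
  move=> t1; rewrite /q exprn_ile1// /ppart ?le_max ?lexx ?orbT//.
  by rewrite ge_max t1 ler01.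
(* The inner argument 1 - q(t - 1) - q(-t - 1) equals 1 for |t| <= 1; for |t| >= 2 one of the
   subtracted terms is at least 1, so the argument is nonpositive and q sends it to 0. *)
exists (q \o (fun t => 1 + - q (t + -1) + - q (- t + -1))); split.
- apply: Cm_comp; first exact: Cm_ppart.
  have Cq g : Cm N g -> Cm N (fun t => - q (g t)).
    by move=> Cg; apply: CmN; apply: (@Cm_comp _ q); [exact: Cm_ppart|].
  apply: CmD; first apply: CmD; first exact: Cm_cst.
    by apply: Cq; apply: CmD; [exact: Cm_id|exact: Cm_cst].
  by apply: Cq; apply: CmD; [exact: CmN (Cm_id N)|exact: Cm_cst].
- move=> t /=; rewrite q0 /=; apply: q2.
  by have := q0 (t + -1); have := q0 (- t + -1); lra.
- move=> t; rewrite ler_norml => /andP[t1 t2] /=.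
  rewrite (qN (t + -1)) ?(qN (- t + -1)); try lra.
  by rewrite !subr0 /q /ppart max_l ?ler01// expr1n.
- move=> t t2 /=; apply: qN; have := q0 (t + -1); have := q0 (- t + -1).
  case: (lerP 0 t) => t0; move: t2; [rewrite ger0_norm//|rewrite ltr0_norm//] => t2 A B.
    by have := q1 (t + -1); lra.
  by have := q1 (- t + -1); lra.
Qed.

(** Each derivative costs one power of z: (z^(K+1) g)' = z^K ((K+1) z' g + z g'). The extra factor g
    makes this form stable under induction. *)
Lemma Cm_exp_chain N K (z g : R -> R) : (N <= K)%N -> Cm N z -> Cm N g ->
  exists d : nat -> R -> R,
  [/\ d 0%N = (fun t => z t ^+ K * g t),
      (forall j, (j < N)%N -> forall t, is_derive t 1 (d j) (d j.+1 t)) &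
      (forall j, (j <= N)%N -> exists2 b : R -> R, continuous b &
         d j = (fun t => z t ^+ (K - j) * b t))].
Proof.
elim: N K g => [K g _ _ cg|N IH [//|K] g NK Cz Cg].
  exists (fun _ t => z t ^+ K * g t); split=> //.
  by case=> // _; rewrite subn0; exists g.
case: (Cz) (Cg) => z' dz cz [g' dg cg].
have [||d [d0 d1 d2]] := IH K (fun t => (K.+1%:R * z' t) * g t + z t * g' t) NK.
- exact: CmS.
- apply: CmD; apply: CmM => //; try exact: CmS.
  by apply: (CmM (Cm_cst _ _)).
exists (fun j => if j is j'.+1 then d j' else fun t => z t ^+ K.+1 * g t).
split=> //.
- case=> [_ t|j jN]; last exact: d1.
  have := dg t; have : is_derive t 1 (fun t => z t ^+ K.+1) ((K.+1%:R * z t ^+ K) *: z' t).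
    by have := @is_deriveX _ _ z K.+1 t 1 (z' t) (dz t); rewrite exprfctE.
  move=> ? ?; apply: is_derive_eq.
  by rewrite d0 /GRing.scale /= exprS; ring.
- case=> [_|j jN]; first by exists g => //; exact: Cm_continuous Cg.
  by have [b cb db] := d2 j jN; exists b.
Qed.

End OneVariable.

(** * Iterated Laplacians of C^k functions *)

Lemma near_eq_continuous (S T : topologicalType) (f g : S -> T) (x : S) :
  (\forall z \near x, f z = g z) ->
  {for x, continuous f} -> {for x, continuous g}.
Proof.
move=> fg cf; rewrite /prop_for /continuous_at -(nbhs_singleton fg).
by apply: cvg_trans cf; apply: near_eq_cvg.
Qed.

(** Negated sums are treated as a unit because -Delta is the negated sum of the second partial
    derivatives. *)
Lemma continuous_oppsum (R : realType) (S : topologicalType) q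
    (G : 'I_q -> S -> R) (x : S) :
  (forall j, {for x, continuous (G j)}) ->
  {for x, continuous (fun x => - \sum_j G j x)}.
Proof.
move=> cG; apply: cvgN.
by apply: (@cvg_big R _ +%R 0 xpredT) => [|j _]; [exact: add_continuous|exact: cG].
Qed.

Section RowVectors.
Variables (R : realType) (n : nat).
Implicit Types (x y : 'rV[R]_n) (f g : 'rV[R]_n -> R) (U : set 'rV[R]_n).

Lemma norm_coord_le x i : `|x ord0 i| <= `|x|.
Proof.
by rewrite [leRHS]/Num.Def.normr /= mx_normrE; apply/bigmax_geP; right => /=; exists (ord0, i).
Qed.

Lemma norm_rV_le x c : 0 <= c -> (forall i, `|x ord0 i| <= c) -> `|x| <= c.
Proof.
move=> c0 xc; rewrite [leLHS]/Num.Def.normr /= mx_normrE; apply/bigmax_leP; split=> //.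
by move=> [i j] _ /=; rewrite ord1.
Qed.

Lemma norm_delta_le i : `|delta_mx ord0 i : 'rV[R]_n| <= 1.
Proof.
by apply: norm_rV_le => // j; rewrite mxE; case: (_ && _); rewrite ?normr1// normr0.
Qed.

Lemma Ck_on_continuous k U f x : Ck_on k U f -> U x -> {for x, continuous f}.
Proof. by case: k => [|k] [+ _] => /[apply]. Qed.

Lemma Ck_onS k U f : Ck_on k.+1 U f -> Ck_on k U f.
Proof.
elim: k f => [|k IH] f [cf pf]; split=> // i.
by have [df Cf] := pf i; split=> //; exact: IH.
Qed.

Lemma Ck_on_le k l U f : (k <= l)%N -> Ck_on l U f -> Ck_on k U f.
Proof.
move=> /subnK <-; elim: (l - k)%N => // j IH Cf.
by apply: IH; apply: Ck_onS; rewrite -addSn.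
Qed.

Lemma Ck_on_partial k U f i : Ck_on k.+1 U f -> Ck_on k U (partial i f).
Proof. by move=> [_ /(_ i)[]]. Qed.

Lemma Ck_on_is_derive k U f x i : Ck_on k.+1 U f -> U x ->
  is_derive x (delta_mx ord0 i) f (partial i f x).
Proof. by move=> [_ /(_ i)[df _]] Ux; apply: derivableP; exact: df. Qed.

Lemma Ck_on_sub k U V f : U `<=` V -> Ck_on k V f -> Ck_on k U f.
Proof.
move=> UV; elim: k f => [|k IH] f [cf pf]; split=> //.
- by move=> x /UV; exact: cf.
- by move=> x /UV; exact: cf.
- move=> i; have [df Cf] := pf i; split; last exact: IH.
  by move=> x /UV; exact: df.
Qed.

Lemma open_near_eq U f g x : open U -> U x ->
  (forall z, U z -> f z = g z) -> \forall z \near x, f z = g z.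
Proof.
by move=> oU Ux fg; have := open_nbhs_nbhs (conj oU Ux); apply: filterS.
Qed.

Lemma Ck_on_eq k U f g : open U -> (forall z, U z -> f z = g z) ->
  Ck_on k U f -> Ck_on k U g.
Proof.
move=> oU; elim: k f g => [|k IH] f g fg [cf pf].
  by split=> // x Ux; exact: near_eq_continuous (open_near_eq oU Ux fg) (cf x Ux).
split=> [x Ux|i].
  exact: near_eq_continuous (open_near_eq oU Ux fg) (cf x Ux).
have [df Cf] := pf i; split.
  by move=> x Ux; apply: (near_eq_derivable (open_near_eq oU Ux fg)); exact: df.
apply: IH Cf => x Ux; apply: near_eq_derive; exact: open_near_eq oU Ux fg.
Qed.

Lemma is_derive_oppsum q (G : 'I_q -> 'rV[R]_n -> R) (dG : 'I_q -> R) x v :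
  (forall j, is_derive x v (G j) (dG j)) ->
  is_derive x v (fun x => - \sum_j G j x) (- \sum_j dG j).
Proof.
move=> GdG; have D := @is_derive_sum _ _ _ q G x v dG GdG.
have := @is_deriveN _ _ _ (\sum_(j < q) G j) x v _ D.
by congr is_derive; apply/funext => z; rewrite /= fct_sumE.
Qed.

Lemma Ck_on_oppsum q k U (G : 'I_q -> 'rV[R]_n -> R) : open U ->
  (forall j, Ck_on k U (G j)) -> Ck_on k U (fun x => - \sum_j G j x).
Proof.
move=> oU; elim: k G => [|k IH] G CG; split.
- by move=> x Ux; apply: continuous_oppsum => j; exact: Ck_on_continuous (CG j) Ux.
- by [].
- by move=> x Ux; apply: continuous_oppsum => j; exact: Ck_on_continuous (CG j) Ux.
- move=> i.
  have D x : U x -> is_derive x (delta_mx ord0 i) (fun x => - \sum_j G j x)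
      (- \sum_j partial i (G j) x).
    by move=> Ux; apply: is_derive_oppsum => j; exact: Ck_on_is_derive (CG j) Ux.
  split=> [x /D dx|]; first exact: (@ex_derive _ _ _ _ _ _ _ dx).
  have := IH _ (fun j => Ck_on_partial i (CG j)).
  apply: Ck_on_eq => // x /D dx; exact: esym (@derive_val _ _ _ _ _ _ _ dx).
Qed.

Lemma partial_oppsum q U (G : 'I_q -> 'rV[R]_n -> R) i x : 
  (forall j, Ck_on 1 U (G j)) -> U x ->
  partial i (fun x => - \sum_j G j x) x = - \sum_j partial i (G j) x.
Proof.
move=> CG Ux; apply: (@derive_val _ _ _ _ _ _ _ _).
by apply: is_derive_oppsum => j; exact: Ck_on_is_derive (CG j) Ux.
Qed.

Lemma partial_eq U f g i x : open U -> U x -> (forall z, U z -> f z = g z) ->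
  partial i f x = partial i g x.
Proof. by move=> oU Ux fg; apply: near_eq_derive; exact: open_near_eq oU Ux fg. Qed.

Lemma laplacian_eq U f g x : open U -> U x -> (forall z, U z -> f z = g z) ->
  laplacian f x = laplacian g x.
Proof.
move=> oU Ux fg; apply: eq_bigr => i _; apply: (partial_eq _ oU Ux) => z Uz.
exact: partial_eq oU Uz fg.
Qed.

Lemma laplacian_oppsum q U (G : 'I_q -> 'rV[R]_n -> R) x : open U ->
  (forall j, Ck_on 2 U (G j)) -> U x ->
  laplacian (fun x => - \sum_j G j x) x = - \sum_j laplacian (G j) x.
Proof.
move=> oU CG Ux; rewrite /laplacian exchange_big -sumrN; apply: eq_bigr => i _.
rewrite -(@partial_oppsum q U (fun j => partial i (G j)) i x) //; last first.
  by move=> j; exact: Ck_on_partial.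
apply: (partial_eq _ oU Ux) => z Uz; apply: (@partial_oppsum q U) => // j.
exact: Ck_onS.
Qed.

Lemma Ck_on_neg_laplacian k U f : open U -> Ck_on k.+2 U f ->
  Ck_on k U (fun x => - laplacian f x).
Proof.
by move=> oU Cf; apply: Ck_on_oppsum => // i; do 2!apply: Ck_on_partial.
Qed.

Lemma Ck_on_neg_laplacian_iter k l U f : open U -> Ck_on (k + l.*2) U f ->
  Ck_on k U (neg_laplacian_iter l f).
Proof.
move=> oU; elim: l k => [|l IH] k; first by rewrite addn0.
move=> Cf; rewrite /neg_laplacian_iter iterS; apply: Ck_on_neg_laplacian => //.
by apply: IH; rewrite !addSn -!addnS.
Qed.

Lemma neg_laplacian_iter_oppsum q l U (G : 'I_q -> 'rV[R]_n -> R) x : open U ->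
  (forall j, Ck_on l.*2 U (G j)) -> U x ->
  neg_laplacian_iter l (fun x => - \sum_j G j x) x =
    - \sum_j neg_laplacian_iter l (G j) x.
Proof.
move=> oU; elim: l x => [//|l IH] x CG Ux.
rewrite {1}/neg_laplacian_iter iterS.
rewrite (@laplacian_eq U _ (fun x => - \sum_j neg_laplacian_iter l (G j) x)) //.
  rewrite (@laplacian_oppsum q U) // => [|j]; last exact: Ck_on_neg_laplacian_iter.
  by rewrite -sumrN.
by move=> z Uz; apply: IH => // j; do 2!apply: Ck_onS; exact: CG.
Qed.

(* Peeling the innermost Laplacian off, whereas the definition exposes the
   outermost one. *)
Lemma neg_laplacian_iterS l U f x : open U -> Ck_on l.+1.*2 U f -> U x ->
  neg_laplacian_iter l.+1 f x =
    - \sum_(i < n) neg_laplacian_iter l (partial i (partial i f)) x.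
Proof.
move=> oU Cf Ux; rewrite /neg_laplacian_iter iterSr -/(neg_laplacian_iter l _).
apply: (@neg_laplacian_iter_oppsum n l U) => // i.
by do 2!apply: Ck_on_partial.
Qed.

End RowVectors.

(** * The difference Laplacian *)

Section Difference.
Variables (R : realType) (n : nat).
Implicit Types (x y z : 'rV[R]_n) (f g : 'rV[R]_n -> R) (U : set 'rV[R]_n) (h : R).
Local Notation e i := (delta_mx ord0 i : 'rV[R]_n).

Definition neg_diff_laplacian h f x : R :=
  - \sum_(i < n) (h ^- 2 * (f (x + h *: e i) + f (x - h *: e i) - 2 * f x)).

Lemma is_derive_translate f c x v df :
  is_derive (x + c) v f df -> is_derive x v (fun z => f (z + c)) df.
Proof.
move=> [Df <-].
have E : (fun h : R => h^-1 *: (((fun z => f (z + c)) \o shift x) (h *: v) - f (x + c))) =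
         (fun h : R => h^-1 *: ((f \o shift (x + c)) (h *: v) - f (x + c))).
  by apply/funext => t /=; rewrite addrA.
split; first by rewrite /derivable E.
by rewrite /derive E.
Qed.

Lemma is_derive_line f x v t df :
  is_derive (x + t *: v) v f df -> is_derive t 1 (fun s => f (x + s *: v)) df.
Proof.
move=> [Df <-].
have E : (fun h : R => h^-1 *: (((fun s => f (x + s *: v)) \o shift t) (h *: 1) - f (x + t *: v))) =
         (fun h : R => h^-1 *: ((f \o shift (x + t *: v)) (h *: v) - f (x + t *: v))).
  apply/funext => s /=; rewrite (_ : s *: (1 : R) = s); last exact: mulr1.
  by rewrite scalerDl addrCA.
split; first by rewrite /derivable E.
by rewrite /derive E.
Qed.

Lemma norm_shift_le x y h i s : `|s| <= h -> `|y + s *: e i - x| <= `|y - x| + h.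
Proof.
move=> sh; rewrite addrAC (le_trans (ler_normD _ _))// lerD2l normrZ.
by rewrite (le_trans _ sh)// ler_piMr// norm_delta_le.
Qed.

(** Differentiation commutes with translations, hence with the difference operator. The k-th iterate
    at x samples f only within distance kh of x, so f has to be differentiable only there; this
    matters near the singularity of u. *)
Lemma is_derive_neg_diff_laplacian_iter k h f f1 x v : 0 <= h ->
  (forall y, `|y - x| <= k%:R * h -> is_derive y v f (f1 y)) ->
  is_derive x v (iter k (neg_diff_laplacian h) f) (iter k (neg_diff_laplacian h) f1 x).
Proof.
move=> h0; elim: k x => [|k IH] x Hf; first by apply: Hf; rewrite subrr normr0 mul0r.
have step y : `|y - x| <= h ->
    is_derive y v (iter k (neg_diff_laplacian h) f) (iter k (neg_diff_laplacian h) f1 y).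
  move=> yx; have Hz z : `|z - y| <= k%:R * h -> is_derive z v f (f1 z).
    move=> zy; have Hzx : `|z - x| <= k.+1%:R * h.
      have -> : k.+1%:R * h = k%:R * h + h by rewrite -natr1 mulrDl mul1r.
      by rewrite -[z - x](subrKA y) (le_trans (ler_normD _ _))// lerD.
    exact: Hf z Hzx.
  exact: IH y Hz.
rewrite !iterS; move: (iter k _ f) (iter k _ f1) step => F F1 step.
apply: is_derive_oppsum => i.
have D0 : is_derive x v F (F1 x) by apply: step; rewrite subrr normr0.
have near_x t : `|t| <= h -> `|x + t *: e i - x| <= h.
  by move=> th; rewrite (le_trans (norm_shift_le _ _ _ th))// subrr normr0 add0r.
have D1 : is_derive x v (fun z => F (z + h *: e i)) (F1 (x + h *: e i)).
  by apply: is_derive_translate; apply: step; rewrite near_x// ger0_norm.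
have D2 : is_derive x v (fun z => F (z - h *: e i)) (F1 (x - h *: e i)).
  apply: is_derive_translate; apply: step; rewrite -scaleNr.
  by rewrite near_x// normrN ger0_norm.
exact: (is_deriveZ (h ^- 2) (is_deriveB (is_deriveD D1 D2) (is_deriveZ 2 D0))).
Qed.

(** Induction on k. By [second_difference_MVT], a second difference of the k-th iterate on f is h^2
    times the k-th iterate on a second partial derivative of f at an intermediate point z, to which
    the induction hypothesis applies. Since z differs from y, the limit is taken jointly in y and
    h. *)
Lemma neg_diff_laplacian_cvg k U f x (eps : R) : open U -> Ck_on k.*2 U f -> U x ->
  0 < eps ->
  \forall d \near 0^'+, forall y h, `|y - x| < d -> 0 < h < d ->
    `|iter k (neg_diff_laplacian h) f y - neg_laplacian_iter k f x| < eps.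
Proof.
move=> oU; elim: k f eps => [|k IH] f eps Cf Ux eps0.
  have := Ck_on_continuous Cf Ux => /cvgrPdist_lt/(_ _ eps0).
  move=> /nbhs_ballP[d /= d0 dU].
  apply: filterS (nbhs_right_lt d0) => r rd y h yx _ /=; rewrite distrC; apply: dU.
  by rewrite mx_norm_ball /ball_ /= distrC (lt_trans yx).
have [r /= r0 rU] : exists2 r : R, 0 < r & forall y, `|y - x| < r -> U y.
  have := open_nbhs_nbhs (conj oU Ux) => /nbhs_ballP[r /= r0 rU]; exists r => // y yx.
  by apply: rU; rewrite mx_norm_ball /ball_ /= distrC.
(* The n directions contribute at most n eps / (n+1), which is strictly below eps, also for n =
   0. *)
have H : \forall d \near 0^'+, forall i y h, `|y - x| < d -> 0 < h < d ->
   `|iter k (neg_diff_laplacian h) (partial i (partial i f)) y -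
      neg_laplacian_iter k (partial i (partial i f)) x| < eps / n.+1%:R.
  apply: filter_forall => i; apply: IH => //; last by rewrite divr_gt0.
  by do 2!apply: Ck_on_partial.
have [d1 [d10 {}H]] := filter_ex (filterI (nbhs_right_gt (0 : R)) H).
(* Intermediate points lie within 2d of x, and all sampled points within (k+2)d; d is taken so small
   that the former is below d1 and the latter at most r. *)
have d2_0 : 0 < 2^-1 * d1 by rewrite mulr_gt0// invr_gt0.
have r2_0 : 0 < k.+2%:R^-1 * r by rewrite mulr_gt0// invr_gt0.
apply: filterS2 (nbhs_right_lt d2_0) (nbhs_right_le r2_0) => d dd1 dr.
move=> y h yx /andP[h0 hd].
have d0 : 0 < d := lt_trans h0 hd.
have dd : d + d < d1 by rewrite -mulr2n -mulr_natl -ltr_pdivlMl.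
rewrite [X in `|_ - X|](neg_laplacian_iterS oU Cf Ux) [X in `|X - _|]/neg_diff_laplacian.
rewrite -opprD normrN -sumrB.
set F := iter k (neg_diff_laplacian h) f.
have P i : exists2 z, `|z - x| < d + d & h ^- 2 * (F (y + h *: e i) + F (y - h *: e i) - 2 * F y) =
    iter k (neg_diff_laplacian h) (partial i (partial i f)) z.
  have near_U z t : `|t| <= h -> `|z - (y + t *: e i)| <= k%:R * h -> U z.
    move=> th zy; apply: rU.
    rewrite -[z - x](subrKA (y + t *: e i)) (le_lt_trans (ler_normD _ _))//.
    rewrite (@le_lt_trans _ _ (k%:R * h + (`|y - x| + h)))//.
      by rewrite lerD// norm_shift_le.
    rewrite (@lt_le_trans _ _ (k.+2%:R * d))//; last by rewrite -ler_pdivlMl.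
    rewrite -[k.+2]addn2 natrD mulrDl ler_ltD//; first by apply: ler_wpM2l => //; exact: ltW.
    by rewrite mulr_natl mulr2n ltrD.
  have [||s sh E] := @second_difference_MVT R (fun t => F (y + t *: e i))
    (fun t => iter k (neg_diff_laplacian h) (partial i f) (y + t *: e i))
    (fun t => iter k (neg_diff_laplacian h) (partial i (partial i f)) (y + t *: e i)) h h0.
  - move=> t th; apply: is_derive_line.
    exact: (is_derive_neg_diff_laplacian_iter (ltW h0)
      (fun z zy => Ck_on_is_derive i Cf (near_U z t th zy))).
  - move=> t th; apply: is_derive_line.
    exact: (is_derive_neg_diff_laplacian_iter (ltW h0)
      (fun z zy => Ck_on_is_derive i (Ck_on_partial i Cf) (near_U z t th zy))).
  exists (y + s *: e i).
    by rewrite (le_lt_trans (norm_shift_le _ _ _ sh))// ltrD.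
  by rewrite -scaleNr; move: E; rewrite scale0r addr0 => ->; rewrite mulKf// gt_eqF ?exprn_gt0.
apply: le_lt_trans (ler_norm_sum _ _ _) _.
apply: (@le_lt_trans _ _ (\sum_(i < n) eps / n.+1%:R)).
  apply: ler_sum => i _; have [z zx ->] := P i; apply: ltW.
  by apply: H; [exact: lt_trans dd|rewrite h0 (lt_trans _ dd)// (lt_trans hd)// ltrDl].
rewrite sumr_const card_ord -[_ *+ n]mulr_natr mulrAC ltr_pdivrMr// ltr_pM2l// ltr_nat.
exact: ltnSn.
Qed.
End Difference.

(** * Test functions *)

Lemma continuous_prod (R : realType) (S : topologicalType) q
    (G : 'I_q -> S -> R) (x : S) :
  (forall j, {for x, continuous (G j)}) ->
  {for x, continuous (fun x => \prod_j G j x)}.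
Proof.
move=> cG.
by apply: (@cvg_big R _ *%R 1 xpredT) => [|j _]; [exact: mul_continuous|exact: cG].
Qed.

(** * Tensor products and their derivatives *)

Section ProductFunctions.
Variables (R : realType) (n : nat) (N : nat) (d : nat -> R -> R).
Hypothesis d_derive : forall j, (j < N)%N -> forall t : R, is_derive t 1 (d j) (d j.+1 t).
Hypothesis d_continuous : forall j, (j <= N)%N -> continuous (d j).
Implicit Types (x y : 'rV[R]_n) (alpha : 'I_n -> nat).

(** As [d j] is the j-th derivative of [d 0], this is the derivative of order alpha of the tensor
    product of n copies of [d 0]. Partial derivatives merely increment alpha. *)
Definition prodfun alpha x : R := \prod_(i < n) d (alpha i) (x ord0 i).

Definition incr (i : 'I_n) alpha : 'I_n -> nat :=
  fun j => if j == i then (alpha j).+1 else alpha j.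

Lemma incr_le k i alpha : (forall j, (alpha j + k.+1 <= N)%N) ->
  forall j, (incr i alpha j + k <= N)%N.
Proof.
move=> H j; rewrite /incr; case: ifP => _; first by rewrite addSnnS.
by rewrite (leq_trans _ (H j))// addnS.
Qed.

Lemma sum_incr i alpha : (\sum_j incr i alpha j = (\sum_j alpha j).+1)%N.
Proof.
rewrite (bigD1 i)//= [in RHS](bigD1 i)//= /incr eqxx addSn; congr (_ + _).+1.
by apply: eq_bigr => j /negbTE ->.
Qed.

Lemma prodfun_continuous alpha : (forall j, (alpha j <= N)%N) -> continuous (prodfun alpha).
Proof.
move=> aN x; apply: continuous_prod => i.
apply: (@continuous_comp _ _ _ (fun x : 'rV[R]_n => x ord0 i) (d (alpha i))).
  exact: coord_continuous.
exact: d_continuous.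
Qed.

Lemma is_derive_prodfun alpha i x : (alpha i < N)%N ->
  is_derive x (delta_mx ord0 i) (prodfun alpha) (prodfun (incr i alpha) x).
Proof.
move=> aN.
suff D : is_derive (0 : R) 1 (fun s : R => prodfun alpha (x + s *: delta_mx ord0 i))
    (prodfun (incr i alpha) x).
  case: D => D <-.
  have E : (fun h : R => h^-1 *: ((prodfun alpha \o shift x) (h *: delta_mx ord0 i) -
        prodfun alpha x)) =
      (fun h : R => h^-1 *:
        (((fun s : R => prodfun alpha (x + s *: delta_mx ord0 i)) \o shift 0) (h *: 1) -
        prodfun alpha (x + 0 *: delta_mx ord0 i))).
    apply/funext => s /=; rewrite (_ : s *: (1 : R) = s); last exact: mulr1.
    by rewrite addr0 scale0r addr0 [_ *: _ + x]addrC.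
  split; first by rewrite /derivable E.
  by rewrite /derive E.
pose c := \prod_(j < n | j != i) d (alpha j) (x ord0 j).
have -> : (fun s : R => prodfun alpha (x + s *: delta_mx ord0 i)) =
    c \*: (fun s => d (alpha i) (s + x ord0 i)).
  apply/funext => s; rewrite /= /prodfun (bigD1 i)//= !mxE !eqxx mulr1 addrC.
  rewrite /GRing.scale /= mulrC; congr (_ * _); apply: eq_bigr => j ji.
  by rewrite !mxE (negbTE ji) andbF mulr0 addr0.
have -> : prodfun (incr i alpha) x = c *: (d (alpha i).+1 (0 + x ord0 i)).
  rewrite /prodfun (bigD1 i)//= /incr eqxx add0r /GRing.scale /= mulrC; congr (_ * _).
  by apply: eq_bigr => j /negbTE ->.
apply: is_deriveZ.
have D := d_derive aN (0 + x ord0 i).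
have := @is_derive1_comp _ _ (shift (x ord0 i)) _ _ _ D (@is_derive_shift R 0 1 (x ord0 i)).
by rewrite mulr1.
Qed.

Lemma partial_prodfun alpha i : (alpha i < N)%N ->
  partial i (prodfun alpha) = prodfun (incr i alpha).
Proof.
move=> aN; apply/funext => x.
exact: (@derive_val _ _ _ _ _ _ _ (is_derive_prodfun x aN)).
Qed.

Lemma Ck_on_prodfun k alpha U : (forall j, (alpha j + k <= N)%N) ->
  Ck_on k U (prodfun alpha).
Proof.
elim: k alpha => [|k IH] alpha aN.
  by split=> // x _; apply: prodfun_continuous => j; rewrite (leq_trans _ (aN j))// leq_addr.
have aN' j : (alpha j < N)%N by rewrite (leq_trans _ (aN j))// addnS ltnS leq_addr.
split=> [x _|i]; first by apply: prodfun_continuous => j; exact: ltnW.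
split=> [x _|]; first exact: (@ex_derive _ _ _ _ _ _ _ (is_derive_prodfun x (aN' i))).
by rewrite partial_prodfun//; apply: IH; exact: incr_le.
Qed.

(** The iterated Laplacian expands into n^l derivatives, each of total order |alpha| + 2l. *)
Lemma neg_laplacian_iter_prodfun_le l alpha x B :
  (forall j, (alpha j + l.*2 <= N)%N) ->
  (forall beta, (forall j, (beta j <= N)%N) ->
     (\sum_j beta j = \sum_j alpha j + l.*2)%N -> `|prodfun beta x| <= B) ->
  `|neg_laplacian_iter l (prodfun alpha) x| <= n%:R ^+ l * B.
Proof.
elim: l alpha => [|l IH] alpha aN H.
  by rewrite mul1r; apply: H; rewrite ?addn0// => j; rewrite (leq_trans _ (aN j))// addn0.
rewrite (@neg_laplacian_iterS _ _ _ [set: _])//; [|exact: openT|exact: Ck_on_prodfun].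
rewrite normrN (le_trans (ler_norm_sum _ _ _))//.
apply: (@le_trans _ _ (\sum_(i < n) n%:R ^+ l * B)); last first.
  by rewrite sumr_const card_ord -[_ *+ n]mulr_natl mulrA -exprS.
have aN1 i j : (incr i alpha j + l.*2.+1 <= N)%N by exact: incr_le.
have aN2 i j : (incr i (incr i alpha) j + l.*2 <= N)%N by exact: incr_le.
apply: ler_sum => i _; rewrite partial_prodfun; last first.
  by rewrite (leq_trans _ (aN i))// doubleS addnS ltnS leq_addr.
rewrite partial_prodfun; last by rewrite (leq_trans _ (aN1 i i))// addnS ltnS leq_addr.
apply: IH => // beta bN bs; apply: H => //.
by rewrite bs !sum_incr doubleS !addnS !addSn.
Qed.

(** Every second difference is h^2 times a second derivative at an intermediate point, so the bound
    does not depend on h. *)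
Lemma neg_diff_laplacian_prodfun_le alpha x h B : 0 < h ->
  (forall j, (alpha j + 2 <= N)%N) ->
  (forall beta y, (forall j, (beta j <= N)%N) ->
     (\sum_j beta j = \sum_j alpha j + 2)%N -> `|prodfun beta y| <= B) ->
  `|neg_diff_laplacian h (prodfun alpha) x| <= n%:R * B.
Proof.
move=> h0 aN H.
rewrite normrN (le_trans (ler_norm_sum _ _ _))//.
apply: (@le_trans _ _ (\sum_(i < n) B)); last first.
  by rewrite sumr_const card_ord -[_ *+ n]mulr_natl.
have aN1 i j : (incr i alpha j + 1 <= N)%N by exact: incr_le.
apply: ler_sum => i _.
have ai : (alpha i < N)%N by rewrite (leq_trans _ (aN i))// addnS ltnS leq_addr.
have ai1 : (incr i alpha i < N)%N by rewrite (leq_trans _ (aN1 i i))// addn1.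
have [||s sh E] := @second_difference_MVT R (fun t => prodfun alpha (x + t *: delta_mx ord0 i))
    (fun t => prodfun (incr i alpha) (x + t *: delta_mx ord0 i))
    (fun t => prodfun (incr i (incr i alpha)) (x + t *: delta_mx ord0 i)) h h0.
- by move=> t th; apply: is_derive_line; exact: (is_derive_prodfun _ ai).
- by move=> t th; apply: is_derive_line; exact: (is_derive_prodfun _ ai1).
move: E; rewrite scale0r addr0 scaleNr => ->.
rewrite mulKf ?gt_eqF ?exprn_gt0//; apply: H; last by rewrite !sum_incr addn2.
by move=> j; have := @incr_le 0 i _ (aN1 i) j; rewrite addn0.
Qed.

End ProductFunctions.

(** * Rescaled cutoffs on R^n *)

Section TestFunctions.
Variable R : realType.

(** The function is z^K for a bump z. Its derivatives up to order N keep the factor z^(K-N), and K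
    <= (K-N) p ensures (z^(K-N))^p <= z^K, as 0 <= z <= 1. *)
Lemma bump_chain (N : nat) (p : R) : 1 < p ->
  exists (d : nat -> R -> R) (z : R -> R) (K : nat) (c : R),
  [/\ [/\ forall t, 0 <= z t <= 1, forall t, `|t| <= 1 -> z t = 1 &
          forall t, 2 <= `|t| -> z t = 0],
      [/\ (0 < K)%N, (N < K)%N & K%:R <= (K - N)%:R * p],
      d 0%N = (fun t => z t ^+ K),
      [/\ forall j, (j < N)%N -> forall t : R, is_derive t 1 (d j) (d j.+1 t) &
          forall j, (j <= N)%N -> continuous (d j)] &
      [/\ 0 <= c, forall j t, (j <= N)%N -> `|d j t| <= c * z t ^+ (K - N) &
          forall j t, (0 < j <= N)%N -> `|t| < 1 -> d j t = 0]].
Proof.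
move=> p1; have [z [Cz z01 z1 z0]] := Cm_bump R N.
have p10 : 0 < p - 1 by rewrite subr_gt0.
(* With K = N + L the inequality K <= (K-N) p reads N <= L (p-1). *)
pose L := (Num.truncn (N%:R / (p - 1))).+1; pose K := (N + L)%N.
have [|d [d0 d1 d2]] := @Cm_exp_chain R N K z (cst 1) _ Cz (Cm_cst N 1).
  exact: leq_addr.
have K0 : (N < K)%N by rewrite /K -addSnnS leq_addr.
have NK := ltnW K0.
have /fin_all_exists[c Hc] : forall j : 'I_N.+1, exists c, 0 <= c /\
    forall t, `|d j t| <= c * z t ^+ (K - N).
  move=> j; have jN : (j <= N)%N by rewrite -ltnS.
  have [b cb ->] := d2 j jN.
  (* The factor b is bounded by its maximum over [-2, 2]; outside, z vanishes and enters with a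
     positive exponent. *)
  have cb2 : {within `[(-2)%R, (2 : R)], continuous (fun t => `|b t|)}.
    apply: continuous_subspaceT => t.
    by apply: (@continuous_comp _ _ _ b); [exact: cb|exact: norm_continuous].
  have [|s _ bs] := EVT_max _ cb2; first by rewrite lerNl (le_trans (_ : _ <= 0)) ?oppr_le0.
  exists `|b s|; split=> // t; have /andP[zt0 zt1] := z01 t.
  case: (lerP 2 `|t|) => t2.
    rewrite z0// !expr0n subn_eq0 leqNgt (leq_ltn_trans jN K0)/=.
    by rewrite subn_eq0 leqNgt K0 mul0r normr0 mulr0.
  rewrite normrM mulrC ler_pM//; first by apply: bs; rewrite in_itv /= -ler_norml ltW.
  rewrite ger0_norm ?exprn_ge0//; apply: ler_wiXn2l => //.
  exact: leq_sub2l.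
exists d, z, K, (\sum_j c j); split.
- by split.
- split=> //; first exact: leq_ltn_trans K0.
  rewrite /K addKn natrD -lerBrDr -[X in _ - X]mulr1 -mulrBr -ler_pdivrMr//.
  exact: ltW (truncnS_gt _).
- by rewrite d0; apply/funext => t; rewrite mulr1.
- split=> // j jN; have [b cb ->] := d2 j jN => t; apply: cvgM; last exact: cb.
  apply: (@continuous_comp _ _ _ z (fun x => x ^+ (K - j))).
    exact: (Cm_continuous Cz).
  exact: exprn_continuous.
- have cj0 j : 0 <= c j by case: (Hc j).
  split.
  + exact: sumr_ge0.
  + move=> j t; rewrite -ltnS => jN; have [_ /(_ t) H] := Hc (Ordinal jN).
    apply: (le_trans H); apply: ler_wpM2r; first by rewrite exprn_ge0//; case/andP: (z01 t).
    by rewrite (bigD1 (Ordinal jN))//= lerDl sumr_ge0.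
  (* [d 0] is 1 on (-1, 1), so by induction all later members of the chain vanish there. *)
  + have dcst a j : (j < N)%N -> (forall t, `|t| < 1 -> d j t = a) ->
        forall t, `|t| < 1 -> d j.+1 t = 0.
      move=> jN ja t t1.
      have D : is_derive t 1 (cst a) (d j.+1 t).
        apply: (near_eq_is_derive _ (d1 j jN t)).
        have := @cvgr_lt R R (nbhs t) (nbhs_filter t) (fun s : R => `|s|) `|t|
          (@norm_continuous R R t) 1 t1.
        by apply: filterS => s s1; rewrite ja.
      by rewrite -(@derive_val _ _ _ _ _ _ _ D) derive_cst.
    case=> // j + /= jN; elim: j jN => [|j IH] jN.
      apply: (dcst 1) => // t t1; rewrite d0 z1 ?expr1n ?mulr1//; exact: ltW.
    by apply: (dcst 0) => //; apply: IH; exact: ltnW.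
Qed.

Lemma powR_exp_le (b p : R) (k l : nat) : 0 <= b <= 1 -> (0 < k)%N -> 0 < p ->
  k%:R <= l%:R * p -> (b ^+ l) `^ p <= b ^+ k.
Proof.
move=> /andP[b0 b1] k0 p0 kl; move: b0; rewrite le_eqVlt => /predU1P[<-|b0].
  (* At b = 0 the convention 0^0 = 1 has to be excluded: l = 0 would force k = 0. *)
  case: l kl => [|l].
    by rewrite mul0r lern0 => /eqP k0'; rewrite k0' in k0.
  by move=> _; rewrite expr0n /= powR0 ?gt_eqF// exprn_ge0.
have b01 : 0 < b <= 1 by rewrite b0.
have b0' := ltW b0; rewrite -(powR_mulrn l b0') -(powR_mulrn k b0') -powRrM.
exact: (ger_powR b01 kl).
Qed.

Lemma norm_rV_attained n (x : 'rV[R]_n) : (0 < n)%N -> exists i, `|x| = `|x ord0 i|.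
Proof.
move=> n0; have [x0|x0] := eqVneq `|x| 0.
  exists (Ordinal n0); apply/eqP; rewrite eq_le x0 normr_ge0 /=.
  by rewrite -x0 norm_coord_le.
by have [[i j] E] := mx_norm_neq0 x0; exists j; rewrite [LHS]E /= ord1.
Qed.

(** With P(x) the product of the z(x_i / r), take phi_r = P^K and Phi_r = P^(K-2m). A derivative of
    order j brings a factor r^-j. As B does not depend on r, the same family supplies the large
    cutoff and the small one around the origin. *)
Lemma test_functions (n m : nat) (p : R) : (0 < n)%N -> (0 < m)%N -> 1 < p ->
  exists (phi Phi : R -> 'rV[R]_n -> R) (B : R), 0 <= B /\ forall r, 0 < r ->
  [/\ [/\ forall x, 0 <= phi r x <= 1, forall x, `|x| <= r -> phi r x = 1 &
          forall x, 2 * r <= `|x| -> phi r x = 0],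
      Ck_on m.*2 [set: 'rV[R]_n] (phi r),
      forall x, 0 <= Phi r x /\ Phi r x `^ p <= phi r x &
      [/\ forall x, `|neg_laplacian_iter m (phi r) x| <= B * r ^- m.*2 * Phi r x,
          forall x, `|x| < r -> neg_laplacian_iter m (phi r) x = 0 &
          forall x h, 0 < h -> `|neg_diff_laplacian h (phi r) x| <= B * r ^- 2]].
Proof.
move=> n0 m0 p1.
have [d [z [K [c [[z01 z1 z0] [K0 NK Kp] d0 [d1 d2] [c0 dc dz]]]]]] := bump_chain m.*2 p1.
pose ds (r : R) j t := r^-1 ^+ j * d j (r^-1 * t).
pose P r (x : 'rV[R]_n) := \prod_(i < n) z (r^-1 * x ord0 i).
pose phi r := prodfun (ds r) (fun=> 0%N) : 'rV[R]_n -> R.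
pose Phi r x := P r x ^+ (K - m.*2).
(* The summands of B serve the bounds on (-Delta)^m and on the single difference Laplacian,
   respectively. *)
exists phi, Phi, (n%:R ^+ m * c ^+ n + n%:R * c ^+ n); split.
  by rewrite addr_ge0// mulr_ge0// ?exprn_ge0.
move=> r r0; have ri0 : 0 <= r^-1 by rewrite invr_ge0 ltW.
have ds1 j : (j < m.*2)%N -> forall t : R, is_derive t 1 (ds r j) (ds r j.+1 t).
  move=> jN t.
  have D : is_derive t 1 (fun t : R => r^-1 * t) (r^-1).
    by have := is_deriveZ r^-1 (@is_derive_id R R t 1); rewrite /GRing.scale /= mulr1.
  have := is_deriveZ (r^-1 ^+ j) (@is_derive1_comp _ _ _ _ _ _ (d1 j jN (r^-1 * t)) D).
  by rewrite /ds exprSr /GRing.scale /= mulrAC mulrA.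
have ds2 j : (j <= m.*2)%N -> continuous (ds r j).
  move=> jN t; apply: cvgM; first exact: cvg_cst.
  apply: (@continuous_comp _ _ _ (fun t => r^-1 * t) (d j)); last exact: d2.
  exact: mulrl_continuous.
have P01 x : 0 <= P r x <= 1.
  apply/andP; split; first by apply: prodr_ge0 => i _; case/andP: (z01 (r^-1 * x ord0 i)).
  by apply: numdomain.Num.Theory.prodr_ile1 => i _; exact: z01.
have phiE x : phi r x = P r x ^+ K.
  by rewrite /phi /prodfun /P -prodrXl; apply: eq_bigr => i _; rewrite /ds mul1r d0.
have dsb beta x : (forall j, (beta j <= m.*2)%N) ->
    `|prodfun (ds r) beta x| <= r^-1 ^+ (\sum_j beta j) * (c ^+ n * Phi r x).
  move=> bN; rewrite /prodfun normr_prod.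
  rewrite /Phi /P -prodrXl -[X in c ^+ X]card_ord -prodr_const.
  rewrite expr_sum -!big_split /=.
  apply: ler_prod => i _; rewrite normr_ge0 /=.
  have r1 k : 0 <= r^-1 ^+ k by rewrite exprn_ge0// invr_ge0 ltW.
  rewrite /ds normrM ger0_norm//; apply: ler_wpM2l => //.
  exact: dc.
have Phi1 x : Phi r x <= 1.
  by have /andP[? ?] := P01 x; rewrite exprn_ile1.
have Phi0 x : 0 <= Phi r x by rewrite exprn_ge0//; case/andP: (P01 x).
have cn0 : 0 <= c ^+ n by rewrite exprn_ge0.
have r10 k : 0 <= r^-1 ^+ k by rewrite exprn_ge0// invr_ge0 ltW.
split.
- split=> x; rewrite phiE.
  + by have /andP[P0 P1] := P01 x; rewrite exprn_ge0//= exprn_ile1.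
  + move=> xr; rewrite /P big1 ?expr1n// => i _; apply: z1.
    rewrite normrM (ger0_norm ri0) ler_pdivrMl// mulr1.
    exact: le_trans (norm_coord_le _ _) xr.
  + have [i ->] := norm_rV_attained x n0 => xr.
    rewrite /P (bigD1 i)//= z0 ?mul0r ?expr0n ?gtn_eqF//.
    by rewrite normrM (ger0_norm ri0) ler_pdivlMl// mulrC.
- by apply: (Ck_on_prodfun ds1 ds2) => j; rewrite add0n.
- by move=> x; split=> //; rewrite phiE; apply: powR_exp_le => //; exact: lt_trans p1.
- split=> [x|x xr|x h h0].
  + apply: (@le_trans _ _ (n%:R ^+ m * (r^-1 ^+ m.*2 * (c ^+ n * Phi r x)))).
      apply: (neg_laplacian_iter_prodfun_le ds1 ds2) => [j|beta bN bs]; first by rewrite add0n.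
      by rewrite (le_trans (dsb _ x bN))// bs big1.
    rewrite -exprVn mulrDl mulrDl; set A := (X in X <= _).
    rewrite -[A]addr0 lerD//; first by rewrite /A le_eqVlt; apply/orP; left; apply/eqP; ring.
    by rewrite !mulr_ge0.
  (* The derivative bound is applied with constant 0: a derivative of total order 2m > 0
     differentiates some factor, which is constant for |x_i| < r. *)
  + apply/eqP; rewrite -normr_le0 -[leRHS](mulr0 (n%:R ^+ m)).
    apply: (neg_laplacian_iter_prodfun_le ds1 ds2) => [j|beta bN]; first by rewrite add0n.
    rewrite big1_eq add0n => bs; have [i bi] : exists i, (0 < beta i)%N.
      apply/existsP; apply: contraT; rewrite negb_exists => /forallP H.
      move: m0; rewrite -double_gt0 -bs big1// => i _; apply/eqP.
      by rewrite -leqn0 leqNgt.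
    rewrite /prodfun (bigD1 i)//= /ds dz ?mulr0 ?mul0r ?normr0 ?bi ?bN//.
    rewrite normrM (ger0_norm ri0) ltr_pdivrMl// mulr1.
    exact: le_lt_trans (norm_coord_le _ _) xr.
  + apply: (@le_trans _ _ (n%:R * (r^-1 ^+ 2 * c ^+ n))).
      apply: (neg_diff_laplacian_prodfun_le ds1) => // [j|beta y bN bs].
        by rewrite add0n -[2%N]/(1.*2) leq_double.
      rewrite (le_trans (dsb _ y bN))// bs big1// ler_wpM2l// ler_piMr//.
    rewrite -exprVn mulrDl addrC -[leLHS]addr0 lerD//; last by rewrite !mulr_ge0.
    by rewrite mulrA mulrAC.
Qed.

End TestFunctions.

(** * Sums over a grid *)

Section Clamp.
Variable R : realType.
Implicit Types u v x : R.

Definition clamp u v x : R := Num.max u (Num.min v x).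

Lemma clampP u v x : u <= v -> [\/ x <= u /\ clamp u v x = u,
  u <= x <= v /\ clamp u v x = x | v <= x /\ clamp u v x = v].
Proof.
move=> uv; rewrite /clamp; have [vx|xv] := leP v x.
  by rewrite max_r//; apply: Or33.
have [xu|ux] := leP x u; first exact: Or31.
by apply: Or32; rewrite !ltW.
Qed.

(** An increment over a unit step is at most 1, and it vanishes unless u < x < v. Widening the
    window to [u, v + 1] in [le_clamp_step] makes every x in [u, v] contribute exactly 1. *)
Lemma clamp_step_le u v x : u + 1 <= v ->
  clamp (u + 1) v (x + 1) - clamp (u + 1) v x <= (u <= x <= v)%R%:R.
Proof.
move=> uv.
by case: (clampP (x + 1) uv) => -[? ->]; case: (clampP x uv) => -[? ->];
  case: (leP u x) => ?; case: (leP x v) => ? /=; lra.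
Qed.

Lemma le_clamp_step u v x : u <= v + 1 ->
  (u <= x <= v)%R%:R <= clamp u (v + 1) (x + 1) - clamp u (v + 1) x.
Proof.
move=> uv.
by case: (clampP (x + 1) uv) => -[? ->]; case: (clampP x uv) => -[? ->];
  case: (leP u x) => ?; case: (leP x v) => ? /=; lra.
Qed.

End Clamp.

Section Grid.
Variables (R : realType) (n M : nat) (h c : R).
Implicit Types (x y w : 'rV[R]_n) (A psi : 'rV[R]_n -> R).
Local Notation e i := (delta_mx ord0 i : 'rV[R]_n).
Local Notation grid := {ffun 'I_n -> 'I_M.+1}.

(** A grid of step h on the box [-hc, h(M-c)]^n; the offset c lets the box surround the origin
    although indices start at 0. *)
Definition grid_point (k : grid) : 'rV[R]_n := \row_j (h * ((k j)%:R - c)).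

(** The weight h^n of a Riemann sum is left out: summation by parts does not see it, and it is
    restored when sums are compared with volumes. *)
Definition grid_sum (F : 'rV[R]_n -> R) : R := \sum_(k : grid) F (grid_point k).

Definition grid_succ (i : 'I_n) (k : grid) : grid :=
  [ffun j => if j == i then ordS (k j) else k j].

Lemma grid_succ_inj i : injective (grid_succ i).
Proof.
move=> k l /ffunP kl; apply/ffunP => j; have := kl j; rewrite !ffunE.
by case: ifP => // _; exact: ordS_inj.
Qed.

(* The index set is a torus; Q vanishes wherever shifting wraps around. *)
Lemma grid_sum_shift i Q rho : 0 < h -> rho <= h * c -> rho <= h * (M.+1%:R - c) ->
  (forall x, rho <= `|x| -> Q x = 0) ->
  grid_sum (fun x => Q (x + h *: e i)) = grid_sum Q.
Proof.
move=> h0 hc hM Q0; rewrite /grid_sum [RHS](reindex_inj (@grid_succ_inj i)).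
apply: eq_bigr => k _; have := ltn_ord (k i); rewrite ltnS leq_eqVlt => /predU1P[kM|kM].
  rewrite !Q0//; apply: le_trans (norm_coord_le _ i); rewrite !mxE.
    rewrite ffunE eqxx /= kM modnn sub0r mulrN normrN.
    by rewrite (le_trans hc)// ler_norm.
  rewrite !eqxx kM (_ : _ + _ = h * (M.+1%:R - c)); last by rewrite -natr1 /=; ring.
  by rewrite (le_trans hM)// ler_norm.
congr Q; apply/rowP => j; rewrite !mxE ffunE eqxx /=.
have [->|ji] := eqVneq j i; last by rewrite mulr0 addr0.
rewrite /= modn_small; last by rewrite ltnS.
by rewrite -natr1 /=; ring.
Qed.

Lemma neg_diff_laplacian_supp psi rho x : 0 < h ->
  (forall x, rho <= `|x| -> psi x = 0) -> rho + h <= `|x| ->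
  neg_diff_laplacian h psi x = 0.
Proof.
move=> h0 psi0 xr; rewrite /neg_diff_laplacian big1 ?oppr0// => i _.
have H t : `|t| <= h -> psi (x + t *: e i) = 0.
  move=> th; apply: psi0; rewrite -(lerD2r h) (le_trans xr)//.
  rewrite -[X in `|X|](addrK (t *: e i)) -scaleNr.
  rewrite (le_trans (ler_normD _ _))// lerD2l normrZ normrN.
  by rewrite (le_trans _ th)// ler_piMr// norm_delta_le.
rewrite H ?gtr0_norm// -scaleNr H ?normrN ?gtr0_norm//.
by rewrite psi0 ?mulr0 ?addr0 ?subr0 ?mulr0// (le_trans _ xr)// lerDl ltW.
Qed.

(** The shifts by h e_i and -h e_i are adjoint under the grid sum and enter the operator
    symmetrically. The margin h keeps the shifted products from wrapping around the box. *)
Lemma grid_sum_by_parts1 A psi rho : 0 < h -> rho + h <= h * c ->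
  rho + h <= h * (M.+1%:R - c) -> (forall x, rho <= `|x| -> psi x = 0) ->
  grid_sum (fun x => neg_diff_laplacian h A x * psi x) =
  grid_sum (fun x => A x * neg_diff_laplacian h psi x).
Proof.
move=> h0 hc hM psi0.
have S1 i : grid_sum (fun x => A (x + h *: e i) * psi x) =
            grid_sum (fun x => A x * psi (x - h *: e i)).
  rewrite -(@grid_sum_shift i (fun x => A x * psi (x - h *: e i)) (rho + h))//.
    by apply: eq_bigr => k _; rewrite addrK.
  move=> x xr; rewrite psi0 ?mulr0// -(lerD2r h) (le_trans xr)//.
  rewrite -[X in `|X|](subrK (h *: e i)) (le_trans (ler_normD _ _))// lerD2l.
  by rewrite normrZ gtr0_norm// ler_piMr ?norm_delta_le// ltW.
have S2 i : grid_sum (fun x => A (x - h *: e i) * psi x) =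
            grid_sum (fun x => A x * psi (x + h *: e i)).
  rewrite -(@grid_sum_shift i (fun x => A (x - h *: e i) * psi x) (rho + h))//.
    by apply: eq_bigr => k _; rewrite addrK.
  by move=> x xr; rewrite psi0 ?mulr0// (le_trans _ xr)// lerDl ltW.
have E f g : grid_sum (fun x => neg_diff_laplacian h f x * g x) =
   - \sum_i h ^- 2 * (grid_sum (fun x => f (x + h *: e i) * g x) +
      grid_sum (fun x => f (x - h *: e i) * g x) - 2 * grid_sum (fun x => f x * g x)).
  rewrite /grid_sum -sumrN.
  under eq_bigr do rewrite /neg_diff_laplacian mulNr mulr_suml -sumrN.
  rewrite exchange_big; apply: eq_bigr => i _ /=.
  rewrite mulr_sumr -big_split /= -sumrB mulr_sumr -sumrN.
  by apply: eq_bigr => k _; ring.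
have C f g : grid_sum (fun x => f x * g x) = grid_sum (fun x => g x * f x).
  by apply: eq_bigr => k _; rewrite mulrC.
rewrite [RHS]C !E; congr (- _); apply: eq_bigr => i _; congr (_ * _).
rewrite S1 S2 (C psi A) (C (fun x => psi (x + h *: e i)) A).
by rewrite (C (fun x => psi (x - h *: e i)) A) [X in X - _]addrC.
Qed.

(** Every application of the operator to psi enlarges its support by h, hence the margin kh. *)
Lemma grid_sum_by_parts k A psi rho : 0 < h -> rho + k%:R * h <= h * c ->
  rho + k%:R * h <= h * (M.+1%:R - c) -> (forall x, rho <= `|x| -> psi x = 0) ->
  grid_sum (fun x => iter k (neg_diff_laplacian h) A x * psi x) =
  grid_sum (fun x => A x * iter k (neg_diff_laplacian h) psi x).
Proof.
move=> h0; elim: k rho psi => [//|k IH] rho psi hc hM psi0.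
have kh : rho + k.+1%:R * h = rho + h + k%:R * h by rewrite -natr1; ring.
rewrite (@grid_sum_by_parts1 _ psi rho)//.
- rewrite (IH (rho + h)) -?kh//; last by move=> x; exact: neg_diff_laplacian_supp.
  by apply: eq_bigr => l _; rewrite iterSr.
- by rewrite (le_trans _ hc)// kh lerDl mulr_ge0// ltW.
- by rewrite (le_trans _ hM)// kh lerDl mulr_ge0// ltW.
Qed.

(* The indicator of [a, b] is compared with the increments of a clamp, whose sum
   telescopes. *)
Lemma sum_nat_interval (a b : R) : 0 <= a -> b <= M%:R -> a + 1 <= b ->
  b - a - 1 <= \sum_(j < M.+1) (a <= j%:R <= b)%R%:R <= b - a + 1.
Proof.
move=> a0 bM ab.
have tele u v : 0 <= u -> u <= v -> v <= M.+1%:R ->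
    \sum_(j < M.+1) (clamp u v (j%:R + 1) - clamp u v j%:R) = v - u.
  move=> u0 uv vM.
  under eq_bigr do rewrite natr1.
  rewrite -(big_mkord xpredT (fun j => clamp u v j.+1%:R - clamp u v j%:R)).
  rewrite telescope_sumr// /clamp (min_l vM) (max_r uv) max_l//.
  by rewrite ge_min u0 orbT.
have M1 : M%:R + 1 = M.+1%:R :> R by rewrite natr1.
apply/andP; split.
- have -> : b - a - 1 = b - (a + 1) by ring.
  rewrite -tele; [|lra|lra|rewrite -M1; lra].
  by apply: ler_sum => j _; exact: clamp_step_le.
- have -> : b - a + 1 = (b + 1) - a by ring.
  rewrite -tele; [|lra|lra|rewrite -M1; lra].
  by apply: ler_sum => j _; apply: le_clamp_step; lra.
Qed.

(** The indicator of a sup-norm ball is a product over the coordinates, so the count factorizes. In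
    each coordinate h times the count lies between 2s - h and 2s + h, hence between s and 3s. *)
Lemma grid_count w s : 0 < h -> h <= s ->
  (forall i, - (h * c) <= w ord0 i - s) -> (forall i, w ord0 i + s <= h * (M%:R - c)) ->
  s ^+ n <= h ^+ n * grid_sum (fun x => (`|x - w| <= s)%R%:R) <= (3 * s) ^+ n.
Proof.
move=> h0 hs ws1 ws2; have s0 : 0 <= s by rewrite (le_trans (ltW h0)).
pose b i (j : 'I_M.+1) : R := (`|h * (j%:R - c) - w ord0 i| <= s)%R%:R.
have -> : grid_sum (fun x => (`|x - w| <= s)%R%:R) = \prod_(i < n) \sum_j b i j.
  rewrite bigA_distr_bigA /=; apply: eq_bigr => k _.
  have [xs|xs] := leP `|grid_point k - w| s.
    rewrite big1// => i _; rewrite /b (_ : _ <= s)//.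
    by apply: le_trans xs; apply: le_trans (norm_coord_le _ i); rewrite !mxE.
  apply/esym/eqP; rewrite prodf_seq_eq0; apply/hasP.
  have /existsP[i Hi] : [exists i, s < `|(grid_point k - w) ord0 i|].
    apply: contraTT xs; rewrite negb_exists -leNgt => /forallP H.
    by apply: norm_rV_le => // i; rewrite leNgt.
  exists i; first by rewrite mem_index_enum.
  by move: Hi; rewrite /b /= !mxE ltNge => /negbTE ->.
have B i : s <= h * \sum_j b i j <= 3 * s.
  have E (j : 'I_M.+1) : b i j = (c + (w ord0 i - s) / h <= j%:R <= c + (w ord0 i + s) / h)%R%:R.
    rewrite /b; congr (nat_of_bool _)%:R; rewrite ler_norml; congr (_ && _).
      by rewrite -lerBrDl ler_pdivrMr//; apply/idP/idP; lra.
    by rewrite -lerBlDl ler_pdivlMr//; apply/idP/idP; lra.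
  under eq_bigr do rewrite E.
  set a' := c + _; set b' := c + _.
  have ba : b' - a' = 2 * s / h by rewrite /a' /b'; field; rewrite gt_eqF.
  have sh1 : 1 <= s / h by rewrite ler_pdivlMr// mul1r.
  have [||| L U] := andP (@sum_nat_interval a' b' _ _ _).
  - rewrite /a' -lerBlDl sub0r ler_pdivlMr// mulNr mulrC; exact: ws1.
  - rewrite /b' -lerBrDl ler_pdivrMr// mulrC; exact: ws2.
  - by rewrite -lerBrDl ba -mulrA; lra.
  have -> : s = h * (s / h) by rewrite mulrCA divff ?mulr1// gt_eqF.
  rewrite [3 * _]mulrCA !ler_pM2l//; move: L U; rewrite ba -mulrA; lra.
rewrite -[X in h ^+ X](card_ord n) -prodr_const -big_split /=.
apply/andP; split.
  rewrite -[X in s ^+ X](card_ord n) -prodr_const.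
  by apply: ler_prod => i _; rewrite s0; case/andP: (B i).
rewrite -[X in _ ^+ X](card_ord n) -prodr_const.
apply: ler_prod => i _; have /andP[B1 ->] := B i; rewrite andbT.
exact: le_trans B1.
Qed.

End Grid.

(** * The Liouville property *)

Section Estimates.
Variable R : realType.

Lemma shell_compact n (s t : R) : compact [set x : 'rV[R]_n | s <= `|x| <= t].
Proof.
apply: bounded_closed_compact.
  exists t; split; first exact: num_real.
  by move=> y ty x /= /andP[_ xt]; rewrite (le_trans xt)// ltW.
have -> : [set x : 'rV[R]_n | s <= `|x| <= t] = (fun x => `|x|) @^-1` `[s, t]%classic.
  by apply/seteqP; split=> x /=; rewrite in_itv.
apply: preimage_closed; first by move=> x _; exact: norm_continuous.
exact: itv_closed.
Qed.

Lemma continuous_shell_bounded n (u : 'rV[R]_n -> R) (s t : R) : continuous u ->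
  exists2 b, 0 <= b & forall x, s <= `|x| <= t -> `|u x| <= b.
Proof.
move=> cu; have cK : compact (u @` [set x : 'rV[R]_n | s <= `|x| <= t]).
  by apply: continuous_compact; [exact: continuous_subspaceT|exact: shell_compact].
have [b [_ Hb]] := compact_bounded cK.
exists (`|b| + 1); first by rewrite addr_ge0.
move=> x xst; apply: (Hb (`|b| + 1)); last by exists x.
by rewrite (le_lt_trans (ler_norm b))// ltrDl.
Qed.

(** Near each x in K the two iterates at y are both within eps/2 of the iterated Laplacian at x;
    compactness yields one threshold for h. *)
Lemma neg_diff_laplacian_uniform n k (U K : set 'rV[R]_n) f (eps : R) : open U ->
  Ck_on k.*2 U f -> compact K -> K `<=` U -> 0 < eps ->
  \forall h \near 0^'+, forall y, K y ->
    `|iter k (neg_diff_laplacian h) f y - neg_laplacian_iter k f y| < eps.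
Proof.
move=> oU Cf /compact_near_coveringP cK KU eps0.
apply: (cK _ _ (fun h y => `|iter k (neg_diff_laplacian h) f y - neg_laplacian_iter k f y| < eps)).
move=> x Kx; have Ux := KU _ Kx.
have e2 : 0 < eps / 2 by rewrite divr_gt0.
have [d [/= d0 Hd]] := filter_ex (filterI (nbhs_right_gt (0 : R))
  (neg_diff_laplacian_cvg oU Cf Ux e2)).
have Cx : {for x, continuous (neg_laplacian_iter k f)}.
  by apply: (@Ck_on_continuous _ _ 0 U) => //; exact: Ck_on_neg_laplacian_iter.
have := Cx => /cvgrPdist_lt/(_ _ e2) => /nbhs_ballP[d' /= d'0 H'].
exists ([set y : 'rV[R]_n | `|y - x| < Num.min d d'], [set h : R | 0 < h < d]).
  split=> /=.
    apply/nbhs_ballP; exists (Num.min d d') => /=; first by rewrite lt_min d0.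
    by move=> y; rewrite mx_norm_ball /ball_ /= distrC.
  by apply: filterS2 (nbhs_right_gt (0 : R)) (nbhs_right_lt d0) => h h0 hd /=; rewrite h0.
move=> [y h] /= [yx hd]; move: yx; rewrite lt_min => /andP[yd yd'].
have A := Hd y h yd hd.
have A' : `|neg_laplacian_iter k f x - neg_laplacian_iter k f y| < eps / 2.
  by apply: H'; rewrite mx_norm_ball /ball_ /= distrC.
rewrite -(subrKA (neg_laplacian_iter k f x)) (le_lt_trans (ler_normD _ _))//.
by rewrite [eps]splitr ltrD.
Qed.

(** This is where a < n enters: r^(n-a) exceeds the constant X = |D| E^a for large r. The witness is
    the larger of r0 and X^(1/(n-a)). *)
Lemma exists_radius (n : nat) (a D E r0 : R) : 0 <= a < n%:R -> 0 <= E -> 0 < r0 ->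
  exists2 r, r0 <= r & D * (E * r) `^ a <= r ^+ n.
Proof.
move=> /andP[a0 an] E0 r00.
have na : 0 < n%:R - a by rewrite subr_gt0.
pose X := `|D| * E `^ a.
have X0 : 0 <= X by rewrite mulr_ge0// powR_ge0.
pose r := Num.max r0 (X `^ (n%:R - a)^-1).
have rr0 : r0 <= r by rewrite le_max lexx.
have rp : 0 < r := lt_le_trans r00 rr0.
exists r => //; rewrite (powRM _ E0 (ltW rp)) mulrA.
apply: (@le_trans _ _ (X * r `^ a)).
  by rewrite ler_wpM2r ?powR_ge0// ler_wpM2r ?powR_ge0// ler_norm.
have Xr : X <= r `^ (n%:R - a).
  have -> : X = (X `^ (n%:R - a)^-1) `^ (n%:R - a).
    by rewrite -powRrM mulVf ?gt_eqF// powRr1.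
  apply: ge0_ler_powR; rewrite ?nnegrE ?powR_ge0//; try exact: ltW.
  by rewrite le_max lexx orbT.
apply: (le_trans (ler_wpM2r (powR_ge0 _ _) Xr)).
rewrite -powRD; last by apply/implyP => _; rewrite gt_eqF.
by rewrite subrK powR_mulrn// ltW.
Qed.

(** Young's inequality without the conjugate exponent: for s > T one has s^(p-1) >= T^(p-1), so the
    second term alone suffices. *)
Lemma young_split (T p s : R) : 0 < T -> 1 < p -> 0 <= s ->
  s <= T + T `^ (1 - p) * s `^ p.
Proof.
move=> T0 p1 s0; have [sT|Ts] := leP s T.
  by rewrite (le_trans sT)// lerDl mulr_ge0// powR_ge0.
have sp : 0 < s := lt_trans T0 Ts.
apply: (@le_trans _ _ (T `^ (1 - p) * s `^ p)); last by rewrite lerDr ltW.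
have -> : s `^ p = s * s `^ (p - 1).
  rewrite -{2}(powRr1 s0) -powRD; first by congr (_ `^ _); ring.
  by apply/implyP => _; rewrite gt_eqF.
rewrite mulrCA ler_peMr// -[1 - p]opprB powRN mulrC ler_pdivlMr ?powR_gt0// mul1r.
by apply: ge0_ler_powR; rewrite ?nnegrE ?subr_ge0 ltW.
Qed.

Lemma enorm_le n (x : 'rV[R]_n) : enorm x <= n%:R * `|x|.
Proof.
rewrite /enorm -[leRHS]ger0_norm ?mulr_ge0// -sqrtr_sqr ler_wsqrtr//.
apply: (@le_trans _ _ (\sum_(i < n) `|x| ^+ 2)).
  apply: ler_sum => i _; rewrite -[_ ^+ 2]real_normK ?num_real//.
  by rewrite lerXn2r ?nnegrE// norm_coord_le.
rewrite sumr_const card_ord -[_ *+ n]mulr_natl exprMn ler_wpM2r ?exprn_ge0//.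
by rewrite -natrX ler_nat; case: n {x} => // n; rewrite leq_pmulr.
Qed.

Lemma enorm_gt0 n (x : 'rV[R]_n) : x != 0 -> 0 < enorm x.
Proof.
move=> x0; rewrite /enorm sqrtr_gt0 lt0r sumr_ge0 ?andbT => [|i _]; last exact: sqr_ge0.
apply: contra x0; rewrite psumr_eq0 => [/allP H|i _]; last exact: sqr_ge0.
apply/eqP/rowP => i; rewrite mxE; apply/eqP; rewrite -sqrf_eq0.
exact: (H i (mem_index_enum i)).
Qed.

End Estimates.

(** * From the equation to an inequality between grid sums *)

Section Assembly.
Variable R : realType.

(** Apply [young_split] to s = u Phi. Then s^p <= u^p phi, and u^p is f times the a-th power of
    [enorm x], itself at most (3nr)^a because the Euclidean norm is at most n times the sup norm.
    The condition on r reduces the coefficient of f phi to 1/2. *)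
Lemma young_test n (a p T B r ux phix Phix : R) (x : 'rV[R]_n) :
  x != 0 -> 0 <= a -> 1 < p -> 0 < T -> 0 <= B -> 0 < r -> 0 <= ux -> 0 <= Phix ->
  Phix `^ p <= phix -> `|x| <= 3 * r ->
  2 * B * T `^ (1 - p) * (n%:R * 3 * r) `^ a <= r ^+ n ->
  ux * (B * r ^- n * Phix) <= T * B * r ^- n + (ux `^ p / enorm x `^ a) * phix / 2.
Proof.
move=> x0 a0 p1 T0 B0 r0 u0 Phi0 Phiphi xr cond.
have e0 := enorm_gt0 x0; have ea0 : 0 < enorm x `^ a by rewrite powR_gt0.
have E0 : 0 <= n%:R * 3 * r by rewrite !mulr_ge0// ltW.
have ea : enorm x `^ a <= (n%:R * 3 * r) `^ a.
  apply: ge0_ler_powR; rewrite ?nnegrE//; first exact: ltW.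
  by rewrite (le_trans (enorm_le x))// -mulrA ler_wpM2l.
set f := ux `^ p / _; have f0 : 0 <= f by rewrite divr_ge0 ?powR_ge0.
have phi0 : 0 <= phix by rewrite (le_trans _ Phiphi) ?powR_ge0.
have sp : (ux * Phix) `^ p <= f * phix * (n%:R * 3 * r) `^ a.
  rewrite powRM// (le_trans (ler_wpM2l (powR_ge0 _ _) Phiphi))//.
  have -> : ux `^ p = f * enorm x `^ a by rewrite /f divfK ?gt_eqF.
  by rewrite mulrAC ler_wpM2l// mulr_ge0.
have Br : 0 <= B * r ^- n by rewrite mulr_ge0// invr_ge0 exprn_ge0// ltW.
have := ler_wpM2l Br (young_split T0 p1 (mulr_ge0 u0 Phi0)).
rewrite mulrCA => H; apply: (le_trans H).
rewrite mulrDr [B * _ * T]mulrC [T * (_ * _)]mulrA lerD2l.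
have := ler_wpM2l (powR_ge0 T (1 - p)) sp => /(ler_wpM2l Br) {}H.
apply: (le_trans H); rewrite ler_pdivlMr//.
rewrite [leLHS](_ : _ =
  f * phix * (2 * B * T `^ (1 - p) * (n%:R * 3 * r) `^ a / r ^+ n)); last by ring.
apply: ler_piMr; first exact: mulr_ge0.
by rewrite ler_pdivrMr ?exprn_gt0// mul1r.
Qed.

(* Nothing is assumed on f 0, which is the junk value of derivatives at the
   singularity: phir - phid vanishes there. *)
Lemma grid_inequality n m M (u f phir phid : 'rV[R]_n -> R) (x0 : 'rV[R]_n)
    (h c r delta rho kappa e A W D : R) :
  0 < h -> h * c = 3 * r -> h * (M%:R - c) = 3 * r -> m.+1%:R * h <= r ->
  0 < delta -> h <= delta -> h <= rho -> 2 * delta <= r ->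
  `|x0| + rho <= r -> 2 * delta + rho <= `|x0| -> 0 <= e -> 0 <= A -> 0 <= W -> 0 <= kappa ->
  [/\ forall x, 0 <= phir x <= 1, forall x, `|x| <= r -> phir x = 1 &
      forall x, 2 * r <= `|x| -> phir x = 0] ->
  [/\ forall x, 0 <= phid x <= 1, forall x, `|x| <= delta -> phid x = 1 &
      forall x, 2 * delta <= `|x| -> phid x = 0] ->
  (forall y, 0 < `|y| -> 0 <= f y) ->
  (forall y, `|y - x0| <= rho -> kappa <= f y) ->
  (forall y, delta <= `|y| <= 3 * r -> f y - e <= iter m.+1 (neg_diff_laplacian h) u y) ->
  (forall y, `|y| <= 3 * r ->
    u y * iter m.+1 (neg_diff_laplacian h) phir y <= A + f y * (phir y - phid y) / 2) ->
  (forall y, `|y| <= 3 * delta -> `|iter m (neg_diff_laplacian h) u y| <= W) ->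
  (forall y, `|neg_diff_laplacian h phid y| <= D) ->
  kappa * rho ^+ n / 2 <= (e + A) * (7 * r) ^+ n + W * D * (9 * delta) ^+ n.
Proof.
move=> h0 hc hM mh d0 hd hrho dr x0r dx0 e0 A0 W0 kappa0 [pr01 pr1 pr0] [pd01 pd1 pd0].
move=> f0 fk F1 F2 F3 F4.
have r0 : 0 < r by lra.
have hM1 : 3 * r <= h * (M.+1%:R - c) by rewrite -[M.+1%:R]natr1 addrAC mulrDr hM mulr1 lerDl ltW.
have h_le_mh : h <= m.+1%:R * h by apply: ler_peMl; [exact: ltW|rewrite ler1n].
pose S := @grid_sum R n M h c.
pose psi x := phir x - phid x.
(* All m+1 difference Laplacians are moved onto [phir], but only one onto [phid]: near the origin
   only the m-th iterate on u is under control. *)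
have parts : S (fun x => iter m.+1 (neg_diff_laplacian h) u x * psi x) =
    S (fun x => u x * iter m.+1 (neg_diff_laplacian h) phir x) -
    S (fun x => iter m (neg_diff_laplacian h) u x * neg_diff_laplacian h phid x).
  rewrite /S -(@grid_sum_by_parts _ _ _ _ _ m.+1 u phir (2 * r))//; [|lra|lra].
  rewrite -(@grid_sum_by_parts1 _ _ _ _ _ _ phid (2 * delta))//; [|lra|lra].
  by rewrite /grid_sum -sumrB; apply: eq_bigr => k _; rewrite mulrBr.
have inbox k : `|@grid_point R n M h c k| <= 3 * r.
  apply: norm_rV_le => [|i]; first by lra.
  rewrite mxE ler_norml; apply/andP; split.
    by rewrite -hc -mulrN ler_pM2l// lerBrDl subrr.
  by rewrite -hM ler_pM2l// lerD2r ler_nat -ltnS.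
have dpsi x : `|x| <= delta -> psi x = 0.
  by move=> xd; rewrite /psi pd1// pr1 ?subrr//; lra.
have psi01 x : 0 <= psi x <= 1.
  have /andP[? ?] := pr01 x; have /andP[? ?] := pd01 x; rewrite /psi.
  have [xd|xd] := leP (2 * delta) `|x|; first by rewrite pd0//; lra.
  by rewrite pr1; lra.
have fpsi0 x : 0 <= f x * psi x.
  have [xd|xd] := leP `|x| delta; first by rewrite dpsi// mulr0.
  by rewrite mulr_ge0// ?f0 ?(lt_trans d0)//; case/andP: (psi01 x).
have L1 : S (fun x => f x * psi x) - S (fun=> e) <=
    S (fun x => iter m.+1 (neg_diff_laplacian h) u x * psi x).
  rewrite /S /grid_sum -sumrB; apply: ler_sum => k _; set x := grid_point _ _ _.
  have [xd|xd] := leP `|x| delta; first by rewrite dpsi// !mulr0 sub0r oppr_le0.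
  have /andP[ps0 ps1] := psi01 x.
  apply: (@le_trans _ _ ((f x - e) * psi x)).
    by rewrite mulrBl lerD2l lerN2 ler_piMr.
  by rewrite ler_wpM2r// F1// inbox ltW.
have L2 : S (fun x => u x * iter m.+1 (neg_diff_laplacian h) phir x) <=
    S (fun=> A) + S (fun x => f x * psi x) / 2.
  rewrite /S /grid_sum mulr_suml -big_split /=; apply: ler_sum => k _.
  exact: F2 (inbox k).
(* The difference Laplacian of [phid] is supported within 2 delta + h <= 3 delta. *)
have L3 : - S (fun x => iter m (neg_diff_laplacian h) u x * neg_diff_laplacian h phid x) <=
    W * D * S (fun x => (`|x - 0| <= 3 * delta)%R%:R).
  rewrite /S /grid_sum mulr_sumr -sumrN; apply: ler_sum => k _; set x := grid_point _ _ _.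
  rewrite subr0; have [xd|xd] := leP `|x| (3 * delta).
    rewrite mulr1 (le_trans (ler_norm _))// normrN normrM.
    exact: (ler_pM (normr_ge0 _) (normr_ge0 _) (F3 _ xd) (F4 _)).
  rewrite (@neg_diff_laplacian_supp _ _ _ phid (2 * delta))// ?mulr0 ?oppr0//.
  by rewrite (le_trans _ (ltW xd))//; lra.
(* On the ball around x0 one has 2 delta <= |x| <= r, so psi = 1 there. *)
have L4 : kappa * S (fun x => (`|x - x0| <= rho)%R%:R) <= S (fun x => f x * psi x).
  rewrite /S /grid_sum mulr_sumr; apply: ler_sum => k _; set x := grid_point _ _ _.
  have [xr|xr] := leP `|x - x0| rho; last by rewrite mulr0.
  have x1 : `|x| <= `|x0| + rho.
    by rewrite -[x in `|x|](subrK x0) addrC (le_trans (ler_normD _ _))// lerD2l.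
  have x2 : `|x0| <= `|x| + rho.
    rewrite -[x0 in leLHS](subrK x) addrC (le_trans (ler_normD _ _))// lerD2l.
    by rewrite distrC.
  rewrite mulr1 /psi pr1; last by lra.
  by rewrite pd0 ?subr0 ?mulr1 ?fk//; lra.
have hn0 : 0 <= h ^+ n by rewrite exprn_ge0// ltW.
(* The box has side 6r and M + 1 points per side, so h (M + 1) = 6r + h <= 7r. *)
have C1 : h ^+ n * S (fun=> 1) <= (7 * r) ^+ n.
  rewrite /S /grid_sum sumr_const card_ffun !card_ord natrX -exprMn.
  have -> : h * M.+1%:R = 6 * r + h.
    by rewrite -[M.+1%:R]natr1 mulrDr mulr1; congr (_ + _); move: hc hM; rewrite mulrBr; lra.
  by rewrite lerXn2r ?nnegrE//; lra.
have /andP[C2 _] : rho ^+ n <= h ^+ n * S (fun x => (`|x - x0| <= rho)%R%:R) <= (3 * rho) ^+ n.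
  apply: grid_count => // i; have := norm_coord_le x0 i; rewrite ler_norml => /andP[? ?].
    by rewrite hc; lra.
  by rewrite hM; lra.
have /andP[_ C3] : (3 * delta) ^+ n <= h ^+ n * S (fun x => (`|x - 0| <= 3 * delta)%R%:R) <=
    (3 * (3 * delta)) ^+ n.
  by apply: grid_count => // [|i|i]; rewrite ?mxE ?hc ?hM; lra.
have Sc b : S (fun=> b) = b * S (fun=> 1).
  by rewrite /S /grid_sum mulr_sumr; apply: eq_bigr => k _; rewrite mulr1.
have D0 : 0 <= D := le_trans (normr_ge0 _) (F4 0).
have AE : 0 <= e + A by rewrite addr_ge0.
(* Chaining [L1] to [L4], half of the sum of f psi is absorbed on the left; multiplying by h^n turns
   counts into volumes. *)
have Q : kappa * (h ^+ n * S (fun x => (`|x - x0| <= rho)%R%:R)) / 2 <=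
   (e + A) * (h ^+ n * S (fun=> 1)) + W * D * (h ^+ n * S (fun x => (`|x - 0| <= 3 * delta)%R%:R)).
  move: L1 L2 L3 L4; rewrite parts (Sc e) (Sc A).
  set s1 := S _; set s2 := S (fun=> 1); set s3 := S _; set s4 := S _; set s5 := S _.
  set s6 := S _ => L1 L2 L3 L4.
  have H : kappa * s6 / 2 <= (e + A) * s2 + W * D * s5 by lra.
  have := ler_wpM2l hn0 H; lra.
apply: (@le_trans _ _ (kappa * (h ^+ n * S (fun x => (`|x - x0| <= rho)%R%:R)) / 2)).
  by rewrite ler_pM2r// ler_wpM2l.
apply: (le_trans Q); rewrite lerD// ler_wpM2l//; first exact: mulr_ge0.
by rewrite (le_trans C3)//; rewrite mulrA -natrM.
Qed.
End Assembly.

(** * Choice of the parameters and conclusion *)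

Section Liouville.
Variable R : realType.

Lemma at_right0P (P : R -> Prop) : (\forall h \near 0^'+, P h) ->
  exists e : R, 0 < e /\ forall h, 0 < h < e -> P h.
Proof.
move=> /nbhs_ballP[e /= e0 He]; exists e; split=> // h /andP[h_gt0 he].
apply: (He h _ h_gt0).
by rewrite -ball_normE /= sub0r normrN gtr0_norm.
Qed.

(** If u(x0) > 0, then f >= kappa0 on a ball of radius rho around x0. The parameters T, r, delta,
    eps, h are chosen in this order so that the right side of [grid_inequality] is at most three
    errors of size kappa/8, while its left side is kappa = kappa0 rho^n / 2 > 0. *)
Lemma liouville_punctured n m (a p : R) (u : 'rV[R]_n -> R) :
  n = m.+2.*2 -> 0 <= a < n%:R -> 1 < p -> (forall x, 0 <= u x) ->
  Ck_on n [set~ (0 : 'rV[R]_n)] u -> Ck_on m.+1.*2 [set: 'rV[R]_n] u ->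
  (forall x, x != 0 -> neg_laplacian_iter m.+2 u x = u x `^ p / enorm x `^ a) ->
  forall x, x != 0 -> u x = 0.
Proof.
move=> En a0n p1 u0 Cu Cu' equ x0 x0_neq0; have a0 : 0 <= a by case/andP: a0n.
apply/eqP; apply: contraT => ux0.
have [f Ef] : {f | f = neg_laplacian_iter m.+2 u} by exists (neg_laplacian_iter m.+2 u).
rewrite -Ef in equ.
have oU : open [set~ (0 : 'rV[R]_n)].
  apply: closed_openC.
  exact: accessible_closed_set1 (hausdorff_accessible (@norm_hausdorff _ _)) 0.
have f_ge0 y : 0 < `|y| -> 0 <= f y.
  by rewrite normr_gt0 => y0; rewrite equ// divr_ge0 ?powR_ge0.
have fx0 : 0 < f x0.
  by rewrite equ// divr_gt0// powR_gt0 ?enorm_gt0// lt0r ux0 u0.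
have Cu2 : Ck_on m.+2.*2 [set~ (0 : 'rV[R]_n)] u by rewrite -En.
have cf : {for x0, continuous f}.
  apply: (@Ck_on_continuous _ _ 0 [set~ 0]); last exact/eqP.
  rewrite Ef; exact: Ck_on_neg_laplacian_iter.
pose kappa0 := f x0 / 2; have kappa0_gt0 : 0 < kappa0 by rewrite divr_gt0.
have [rho1 rho1_gt0 Hrho1] : exists2 s : R, 0 < s & forall y, `|y - x0| < s -> kappa0 <= f y.
  have := cf => /cvgrPdist_lt/(_ _ kappa0_gt0)/nbhs_ballP[s /= s0 Hs].
  exists s => // y ys.
  have : `|f x0 - f y| < kappa0.
    apply: Hs.
    by rewrite mx_norm_ball /ball_ /= distrC.
  by rewrite /kappa0 => /ltr_normlW; lra.
have nx0 : 0 < `|x0| by rewrite normr_gt0.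
pose rho := Num.min (rho1 / 2) (`|x0| / 2).
have rho_gt0 : 0 < rho by rewrite lt_min !divr_gt0.
have rho_le : rho <= `|x0| / 2 by rewrite ge_min lexx orbT.
have Hrho y : `|y - x0| <= rho -> kappa0 <= f y.
  move=> yr; apply: Hrho1; apply: (le_lt_trans yr).
  by rewrite /rho gt_min ltr_pdivrMr// ltr_pMr// ltr1n.
clearbody rho; have n_gt0 : (0 < n)%N by rewrite En.
have [phi [Phi [B [B0 Hphi]]]] := @test_functions R n m.+2 p n_gt0 isT p1.
pose kappa := kappa0 * rho ^+ n / 2.
have kappa_gt0 : 0 < kappa by rewrite divr_gt0// mulr_gt0// exprn_gt0.
(* Over a box of side 7r the remainder T B r^-n of Young's inequality amounts to T B 7^n whatever r
   is, so T can be fixed before r. The added 1 covers B = 0. *)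
pose T := kappa / 8 / (B * 7 ^+ n + 1).
have B7 : 0 <= B * 7 ^+ n by rewrite mulr_ge0// exprn_ge0.
have B71 : 0 < B * 7 ^+ n + 1 by rewrite ltr_wpDl.
have kappa8 : 0 < kappa / 8 by exact: divr_gt0.
have T_gt0 : 0 < T by exact: divr_gt0.
have HT : T * B * 7 ^+ n <= kappa / 8.
  rewrite -mulrA /T -mulrA ler_piMr//; first exact: ltW.
  by rewrite mulrC ler_pdivrMr// mul1r lerDl.
have rr0 : 0 < `|x0| + rho by rewrite addr_gt0.
have n3 : 0 <= n%:R * 3 :> R by rewrite mulr_ge0.
have [r r_ge Hr] := exists_radius (2 * B * T `^ (1 - p)) a0n n3 rr0.
have r_gt0 : 0 < r := lt_le_trans rr0 r_ge.
have [[pr01 pr1 pr0] Cpr PPr [Lpr Lpr0 _]] := Hphi r r_gt0.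
(* As u is C^(n-2) at 0, the (m+1)-st iterated difference of u converges there, which bounds it by W
   near 0, uniformly in small h. *)
have [d1 [d1_gt0 Hd1]] := filter_ex (filterI (nbhs_right_gt (0 : R))
  (neg_diff_laplacian_cvg openT Cu' (I : [set: 'rV[R]_n] 0) ltr01)).
pose W := `|neg_laplacian_iter m.+1 u 0| + 1.
have W_gt0 : 0 < W by rewrite ltr_wpDl.
(* In this order: the small cutoff avoids the ball at x0; its support fits in |x| <= r; 3 delta <
   d1; delta <= 1; the term at the origin is at most kappa/8. *)
pose delta := Num.min (Num.min (`|x0| / 4) (r / 2)) (Num.min (Num.min (d1 / 4) 1)
  (kappa / 8 / (W * B * 9 ^+ n + 1))).
have WB : 0 <= W * B * 9 ^+ n by rewrite mulr_ge0 ?exprn_ge0// mulr_ge0// ltW.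
have delta_gt0 : 0 < delta.
  have W1 : 0 < W * B * 9 ^+ n + 1 by rewrite ltr_wpDl.
  by rewrite !lt_min ltr01 (divr_gt0 kappa8 W1) !divr_gt0.
have [dx0 dr dd1 dle1 dW] : [/\ delta <= `|x0| / 4, delta <= r / 2, delta <= d1 / 4,
    delta <= 1 & delta <= kappa / 8 / (W * B * 9 ^+ n + 1)].
  by split; rewrite /delta !ge_min lexx ?orbT.
clearbody delta; have [[pd01 pd1 pd0] _ _ [_ _ Lpd]] := Hphi delta delta_gt0.
have cu : continuous u by move=> x; exact: Ck_on_continuous Cu' I.
have [b b0 Hb] := continuous_shell_bounded 0 (3 * r) cu.
have r7 : 0 < (7 * r) ^+ n by rewrite exprn_gt0// mulr_gt0.
(* It bounds two discretization errors, one for u and one for the large cutoff, the latter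
   multiplied by u <= b. *)
pose eps := kappa / 8 / ((1 + b) * (7 * r) ^+ n).
have b1 : 0 < 1 + b by exact: ltr_wpDr.
have eps_gt0 : 0 < eps by exact: divr_gt0 kappa8 (mulr_gt0 b1 r7).
have KU : [set x : 'rV[R]_n | delta <= `|x| <= 3 * r] `<=` [set~ 0].
  by move=> y /= /andP[dy _] y0; move: dy; rewrite y0 normr0 leNgt delta_gt0.
have H1 := neg_diff_laplacian_uniform oU Cu2 (@shell_compact R n delta (3 * r)) KU eps_gt0.
have H2 := neg_diff_laplacian_uniform openT Cpr (@shell_compact R n 0 (3 * r))
  (@subsetT _ _) eps_gt0.
pose h0 := Num.min (Num.min (r / m.+2%:R) rho) (Num.min delta (d1 / 4)).
have h0_gt0 : 0 < h0.
  have min_gt0 (s t : R) : 0 < s -> 0 < t -> 0 < Num.min s t.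
    by move=> ? ?; rewrite lt_min; apply/andP.
  by apply: (min_gt0); apply: (min_gt0) => //; exact: divr_gt0.
have [eta [eta_gt0 Heta]] : exists eta : R, 0 < eta /\ forall h, 0 < h < eta ->
  [/\ h <= h0, (forall y : 'rV[R]_n, delta <= `|y| <= 3 * r ->
    `|iter m.+2 (neg_diff_laplacian h) u y - neg_laplacian_iter m.+2 u y| < eps) &
    (forall y : 'rV[R]_n, 0 <= `|y| <= 3 * r ->
    `|iter m.+2 (neg_diff_laplacian h) (phi r) y - neg_laplacian_iter m.+2 (phi r) y| < eps)].
  by apply: at_right0P; apply: filterS3 H1 H2 (nbhs_right_le h0_gt0).
(* L steps of length h make exactly 3r, so the grid with M = 2L and c = L spans the cube |x| <= 3r;
   L is large enough for h < eta. *)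
pose L := (Num.truncn (3 * r / eta)).+1; pose h := 3 * r / L%:R.
have r3 : 0 < 3 * r by rewrite mulr_gt0.
have h_gt0 : 0 < h by rewrite divr_gt0.
have h_eta : h < eta.
  have : 3 * r / eta < L%:R := truncnS_gt _.
  by rewrite ltr_pdivrMr// /h ltr_pdivrMr// [eta * _]mulrC.
have [hh0 H1h H2h] := Heta h (introT andP (conj h_gt0 h_eta)).
have {hh0}[hr hrho hd hd1] : [/\ h <= r / m.+2%:R, h <= rho, h <= delta & h <= d1 / 4].
  by split; apply: (le_trans hh0); rewrite /h0 !ge_min lexx ?orbT.
have hL : h * L%:R = 3 * r by rewrite /h divfK// /L pnatr_eq0.
have hM : h * ((L + L)%:R - L%:R) = 3 * r by rewrite natrD addrK.
pose A := T * B * r ^- n + eps * b.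
have rn0 : 0 <= r ^- n by rewrite invr_ge0 exprn_ge0// ltW.
have TB : 0 <= T * B * r ^- n := mulr_ge0 (mulr_ge0 (ltW T_gt0) B0) rn0.
have A0 : 0 <= A.
  exact: addr_ge0 TB (mulr_ge0 (ltW eps_gt0) b0).
have := @grid_inequality R n m.+1 (L + L) u f (phi r) (phi delta) x0 h L%:R r delta rho
  kappa0 eps A W (B * delta ^- 2).
have mhr : m.+2%:R * h <= r by rewrite mulrC -ler_pdivlMr.
have dx0' : 2 * delta + rho <= `|x0| by move: dx0 rho_le; clear; lra.
have dr' : 2 * delta <= r by move: dr; clear; lra.
move=> /(_ h_gt0 hL hM mhr delta_gt0 hd hrho dr' r_ge dx0' (ltW eps_gt0) A0 (ltW W_gt0)
  (ltW kappa0_gt0)).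
move=> /(_ (And3 pr01 pr1 pr0) (And3 pd01 pd1 pd0) f_ge0 Hrho).
have F1 y : delta <= `|y| <= 3 * r -> f y - eps <= iter m.+2 (neg_diff_laplacian h) u y.
  by move=> /H1h; rewrite -Ef distrC => /ltr_normlW; clear; lra.
have F2 y : `|y| <= 3 * r -> u y * iter m.+2 (neg_diff_laplacian h) (phi r) y <=
    A + f y * (phi r y - phi delta y) / 2.
  move=> yr; have y0r : 0 <= `|y| <= 3 * r by rewrite normr_ge0.
  have ub : u y <= b by apply: le_trans (ler_norm _) (Hb y y0r).
  have E1 : u y * iter m.+2 (neg_diff_laplacian h) (phi r) y <=
      u y * `|neg_laplacian_iter m.+2 (phi r) y| + eps * b.
    have /ltr_normlW Z := H2h y y0r.
    have Z' : iter m.+2 (neg_diff_laplacian h) (phi r) y <=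
        `|neg_laplacian_iter m.+2 (phi r) y| + eps.
      by have := ler_norm (neg_laplacian_iter m.+2 (phi r) y); move: Z; clear; lra.
    apply: (le_trans (ler_wpM2l (u0 y) Z')).
    by rewrite mulrDr lerD2l mulrC ler_wpM2l// ltW.
  apply: (le_trans E1); rewrite /A addrAC lerD2r.
  (* For |y| < r the Laplacian of the large cutoff vanishes and the right side is nonnegative;
     beyond, the small cutoff is 0 and [young_test] applies. *)
  have [ylt|yge] := ltP `|y| r.
    rewrite Lpr0// normr0 mulr0; apply: addr_ge0 => //; apply: divr_ge0 => //.
    have [yd|yd] := leP `|y| delta; first by rewrite pd1// pr1 ?subrr ?mulr0// ltW.
    rewrite (pr1 y (ltW ylt)); apply: mulr_ge0; first exact: f_ge0 (lt_trans delta_gt0 yd).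
    by rewrite subr_ge0; case/andP: (pd01 y).
  rewrite pd0 ?subr0; last by rewrite (le_trans _ yge).
  have y_neq0 : y != 0 by rewrite -normr_gt0 (lt_le_trans r_gt0).
  have [Ph0 PhP] := PPr y.
  have := young_test y_neq0 a0 p1 T_gt0 B0 r_gt0 (u0 y) Ph0 PhP yr Hr.
  rewrite -equ//; apply: le_trans; rewrite ler_wpM2l//.
  by have := Lpr y; rewrite -En.
have F3 y : `|y| <= 3 * delta -> `|iter m.+1 (neg_diff_laplacian h) u y| <= W.
  move=> yd; have Z := Hd1 y h; rewrite subr0 in Z.
  have {}Z : `|iter m.+1 (neg_diff_laplacian h) u y - neg_laplacian_iter m.+1 u 0| < 1.
    apply: Z; first by move: yd dd1 d1_gt0; clear; lra.
    by rewrite h_gt0; move: hd1 d1_gt0; clear; lra.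
  rewrite -[X in `|X|](subrK (neg_laplacian_iter m.+1 u 0)) addrC.
  by rewrite (le_trans (ler_normD _ _))// /W lerD2l ltW.
move=> /(_ F1 F2 F3 (fun y => Lpd y h h_gt0)).
have -> : (eps + A) * (7 * r) ^+ n = eps * ((1 + b) * (7 * r) ^+ n) + T * B * 7 ^+ n.
  by rewrite /A exprMn; field; rewrite gt_eqF// exprn_gt0.
have -> : eps * ((1 + b) * (7 * r) ^+ n) = kappa / 8.
  by rewrite /eps divfK// gt_eqF// mulr_gt0.
(* The term at the origin scales as delta^(n-2), which is at most delta since n - 2 >= 1 and delta
   <= 1. *)
have dn : W * (B * delta ^- 2) * (9 * delta) ^+ n <= kappa / 8.
  have -> : W * (B * delta ^- 2) * (9 * delta) ^+ n =
      W * B * 9 ^+ n * (delta ^- 2 * delta ^+ n) by rewrite exprMn; ring.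
  have dn1 : delta ^- 2 * delta ^+ n <= delta.
    rewrite En !doubleS -[_.+4]/(2 + (m.*2).+2)%N exprD mulKf ?gt_eqF ?exprn_gt0//.
    by rewrite exprS ler_piMr ?exprn_ile1// ltW.
  apply: (le_trans (ler_wpM2l WB dn1)).
  move: dW; rewrite ler_pdivlMr ?ltr_wpDl//; apply: le_trans.
  by rewrite mulrDr mulr1 mulrC lerDl ltW.
rewrite -/kappa; move: HT dn kappa_gt0; clear; lra.
Qed.
Lemma continuous_eq0_punctured n (u : 'rV[R]_n -> R) : (0 < n)%N ->
  {for 0, continuous u} -> (forall x, x != 0 -> u x = 0) -> forall x, u x = 0.
Proof.
move=> n0 cu ux x; have [->|/ux//] := eqVneq x 0.
apply/eqP; apply: contraT; rewrite -normr_gt0 => u0.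
have := cu => /cvgrPdist_lt/(_ _ u0)/nbhs_ballP[s /= s0 Hs].
pose y : 'rV[R]_n := (s / 2) *: delta_mx ord0 (Ordinal n0).
have s2 : 0 < s / 2 by rewrite divr_gt0.
have y0 : y != 0.
  apply/eqP => /rowP /(_ (Ordinal n0)); rewrite !mxE !eqxx mulr1 => /eqP.
  by rewrite gt_eqF.
have ys : `|y| < s.
  rewrite normrZ gtr0_norm// (@le_lt_trans _ _ (s / 2))//.
    by rewrite ler_piMr ?norm_delta_le// ltW.
  by rewrite ltr_pdivrMr// ltr_pMr// ltr1n.
have : `|u 0 - u y| < `|u 0|.
  apply: Hs.
  by rewrite mx_norm_ball /ball_ /= sub0r normrN.
by rewrite (ux y y0) subr0 ltxx.
Qed.

End Liouville.

Theorem theorem1p1 (R : realType) (n : nat) (a p : R) (u : 'rV[R]_n -> R)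
  (n_ge4 : (4 <= n)%N) (n_even : ~~ odd n)
  (a_ge0 : 0 <= a) (a_ltn : a < n%:R) (p_gt1 : 1 < p)
  (u_ge0 : forall x, 0 <= u x)
  (u_sol :
     (a = 0 /\ Ck_on n [set: 'rV[R]_n] u /\
      forall x, neg_laplacian_iter n./2 u x = u x `^ p / enorm x `^ a) \/
     (0 < a /\ Ck_on n [set~ (0 : 'rV[R]_n)] u /\
      Ck_on (n - 2) [set: 'rV[R]_n] u /\
      forall x, x != 0 ->
        neg_laplacian_iter n./2 u x = u x `^ p / enorm x `^ a))
  (cond : 0 <= a <= 2 + 2 * p \/
          u =o_ (at_infinity R n) (fun x => enorm x ^+ 2)) :
  forall x, u x = 0.
Proof.
have [m nm] : exists m, n./2 = m.+2.
  by exists (n./2 - 2)%N; rewrite -addn2 subnK// (half_leq n_ge4).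
have En : n = m.+2.*2 by rewrite -nm even_halfK.
have E2 : (n - 2)%N = m.+1.*2 by rewrite En doubleS -addn2 addnK.
(* Both cases are brought to the same form: u is C^n and solves the equation off the origin, and is
   C^(n-2) everywhere. *)
have [Cu [Cu' equ]] : Ck_on n [set~ (0 : 'rV[R]_n)] u /\
    Ck_on (n - 2) [set: 'rV[R]_n] u /\
    forall x, x != 0 -> neg_laplacian_iter n./2 u x = u x `^ p / enorm x `^ a.
  case: u_sol => [[_ [Cu equ]]|[_ //]]; split; first exact: Ck_on_sub (@subsetT _ _) Cu.
  by split=> //; apply: Ck_on_le Cu; exact: leq_subr.
rewrite nm in equ; rewrite E2 in Cu'.
apply: continuous_eq0_punctured; first by rewrite En.
  exact: Ck_on_continuous Cu' I.
apply: (liouville_punctured En _ p_gt1 u_ge0 Cu Cu' equ).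
by rewrite a_ge0.
Qed.
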